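(* Let $p>0$ and $q\ge 0$ be integers and let $\Lambda$ be a simplex of $\mathbb{H}^{p,q}$. Then $\Lambda$ has infinite volume if and only if the graph $\mathcal{G}(\Lambda)$ contains a non-empty stable set of vertices $I$ such that $\mathrm{Card}\, I \ge \mathrm{Card}\, \partial I$.
   Context: Let $\mathbb{R}^{p,q+1}$ be the oriented vector space $\mathbb{R}^{p+q+1}$ endowed with a non-degenerate symmetric bilinear form $\mathbf{b}$ of signature $(p,q+1)$ ($p$ positive, $q+1$ negative directions). The pseudo-hyperbolic space is $\mathbb{H}^{p,q}=\{[x]\in\mathbb{P}(\mathbb{R}^{p,q+1}) \mid \mathbf{b}(x,x)<0\}$. It is the quotient by $\pm\mathrm{id}$ of $\hat{\mathbb{H}}^{p,q}=\{x\in\mathbb{R}^{p,q+1}\mid \mathbf{b}(x,x)=-1\}$, which carries the pseudo-Riemannian metric of signature $(p,q)$ given by restricting $\mathbf{b}$ to $T_x\hat{\mathbb{H}}^{p,q}=x^\perp$; this metric descends to $\mathbb{H}^{p,q}$, and volumes are taken with respect to it. A lift of a subset $\Lambda\subset\mathbb{P}(\mathbb{R}^{p,q+1})$ is a map $s$ choosing, for every line $\xi\in\Lambda$, a non-zero vector $s(\xi)\in\xi$. A lift $s$ is positive if the convex hull $\mathrm{Conv}(s(\Lambda))\subset\mathbb{R}^{p,q+1}$ does not contain $0$ and $\mathbf{b}(s(\xi),s(\eta))\le 0$ for all $\xi,\eta\in\Lambda$ (including $\xi=\eta$). If $s$ is positive, $\mathrm{Conv}(s)$ denotes the interior of the image of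 $\mathrm{Conv}(s(\Lambda))$ in $\mathbb{P}(\mathbb{R}^{p,q+1})$; it is an open subset of $\mathbb{H}^{p,q}$. A convex hull of $\Lambda$ is any set $\mathrm{Conv}(s)$ with $s$ a positive lift of $\Lambda$. A polytope in $\mathbb{H}^{p,q}$ is a finite subset $\Lambda$ of $\mathbb{P}(\mathbb{R}^{p,q+1})$ admitting a positive lift and such that each of its points is extremal in a convex hull of $\Lambda$ (it is not a non-trivial convex combination of points of $\Lambda$). A simplex of $\mathbb{H}^{p,q}$ is a polytope with $p+q+1$ points (vertices) spanning the vector space $\mathbb{R}^{p,q+1}$. The convex hull of a simplex is unique up to isometry of $\mathbb{H}^{p,q}$; its volume is called the volume of $\Lambda$. The graph $\mathcal{G}(\Lambda)$ is the undirected graph (loops allowed) with vertex set $\Lambda$ whose edges are the sets $\{\xi,\eta\}\subset\Lambda$ (possibly $\xi=\eta$, giving a loop) such that the lines $\xi$ and $\eta$ are not $\mathbf{b}$-orthogonal. Given a set $I$ of vertices, $\partial I$ is the set of vertices that are not in $I$ but are adjacent to a vertex of $I$. The set $I$ is stable if there is no edge (in particular no loop) between vertices of $I$. *)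

(* Defs.v *)
From HB Require Import structures.
From mathcomp Require Import all_boot all_order all_algebra finmap.
From mathcomp Require Import all_classical all_reals all_analysis.
Set Implicit Arguments.
Unset Strict Implicit.
Unset Printing Implicit Defensive.
Import Order.TTheory GRing.Theory Num.Theory.
Import numFieldNormedType.Exports.
Local Open Scope classical_set_scope.
Local Open Scope ring_scope.

Section LebesgueTuple.
Context {R : realType}.
Local Notation RR := (measurableTypeR R).

Definition tcons n (xy : RR * n.-tuple RR) : n.+1.-tuple RR :=
  [tuple of xy.1 :: xy.2].

Lemma measurable_tcons n : measurable_fun [set: RR * n.-tuple RR] (@tcons n).
Proof.
exact: (measurable_cons (measurable_fst : measurable_fun setT fst)
                        (measurable_snd : measurable_fun setT snd)).
Qed.

Lemma measurable_tuncons n : measurable_fun [set: n.+1.-tuple RR]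
  (fun t => (thead t, [tuple of behead t]) : RR * n.-tuple RR).
Proof.
apply: measurable_fun_pair; first exact: measurable_tnth.
exact: measurable_behead.
Qed.

Section Step.
Variables (n : nat) (m : {sigma_finite_measure set (n.-tuple RR) -> \bar R}).

Definition tuple_measureS : set (n.+1.-tuple RR) -> \bar R :=
  pushforward (@lebesgue_measure R \x m)%E (@tcons n).

Let tuple_measureS0 : tuple_measureS set0 = 0%E.
Proof. by rewrite /tuple_measureS /pushforward preimage_set0 measure0. Qed.

Let tuple_measureS_ge0 A : (0 <= tuple_measureS A)%E.
Proof. by rewrite /tuple_measureS /pushforward measure_ge0. Qed.

Let tuple_measureS_sigma_additive : semi_sigma_additive tuple_measureS.
Proof.
move=> F mF tF mUF; rewrite /tuple_measureS /pushforward preimage_bigcup.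
apply: measure_semi_sigma_additive.
- by move=> k; rewrite -[X in measurable X]setTI; exact: measurable_tcons.
- apply/trivIsetP => /= i j _ _ ij; rewrite -preimage_setI.
  by move/trivIsetP : tF => /(_ _ _ _ _ ij) ->//; rewrite preimage_set0.
- by rewrite -preimage_bigcup -[X in measurable X]setTI; exact: measurable_tcons.
Qed.

HB.instance Definition _ := isMeasure.Build _ _ _ tuple_measureS
  tuple_measureS0 tuple_measureS_ge0 tuple_measureS_sigma_additive.

Let tuple_measureS_sigma_finite : sigma_finite setT tuple_measureS.
Proof.
have /sigma_finiteP[F [TF ndF Foo]] := sigma_finiteT (@lebesgue_measure R).
have /sigma_finiteP[G [TG ndG Goo]] := sigma_finiteT m.
pose u (t : n.+1.-tuple RR) : RR * n.-tuple RR := (thead t, [tuple of behead t]).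
have uK x t : u (tcons (x, t)) = (x, t).
  by rewrite /u theadE; congr pair; exact/val_inj.
exists (fun k => u @^-1` (F k `*` G k)).
  apply/seteqP; split => // t _.
  have [i _ Fi] : (\bigcup_i F i) (u t).1 by rewrite -TF.
  have [j _ Gj] : (\bigcup_i G i) (u t).2 by rewrite -TG.
  exists (maxn i j) => //; split.
  - by move: Fi; exact/subsetPset/ndF/leq_maxl.
  - by move: Gj; exact/subsetPset/ndG/leq_maxr.
move=> k; have [mF Fk] := Foo k; have [mG Gk] := Goo k; split.
  rewrite -[X in measurable X]setTI; apply: measurable_tuncons => //.
  exact: measurableX.
rewrite /tuple_measureS /pushforward.
rewrite (_ : _ @^-1` _ = F k `*` G k); last first.
  apply/seteqP; split => -[x t].
    by move=> H; have : (F k `*` G k) (u (tcons (x, t))) by []; rewrite uK.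
  by move=> H; change ((F k `*` G k) (u (tcons (x, t)))); rewrite uK.
by rewrite product_measure1E// lte_mul_pinfty// ge0_fin_numE.
Qed.

HB.instance Definition _ := Measure_isSigmaFinite.Build _ _ _ tuple_measureS
  tuple_measureS_sigma_finite.

End Step.

(* Lebesgue measure on R^n, as the iterated product of the one on R. *)
Fixpoint lebesgue_tuple n : {sigma_finite_measure set (n.-tuple RR) -> \bar R} :=
  if n is k.+1 return {sigma_finite_measure set (n.-tuple RR) -> \bar R}
  then tuple_measureS (lebesgue_tuple k) else \d_([tuple] : 0.-tuple RR).

End LebesgueTuple.

Section PseudoHyperbolic.
Context {R : realType}.

Section Form.
Context {n : nat}.
Local Notation V := 'rV[R]_n.+1.

(* The projective space P(R^(n+1)): a point is a line of R^(n+1). *)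
Definition pspace := {xi : {vspace V} | \dim xi == 1%N}.
HB.instance Definition _ := Choice.on pspace.

Implicit Types (xi eta : pspace) (U : set pspace) (C : set V).

Definition pimage C : set pspace :=
  [set xi : pspace | exists x, [/\ C x, x != 0 & x \in val xi]].

(* U is open for the quotient topology of V \ {0} -> P(V). *)
Definition popen U : Prop :=
  open [set x : V | x != 0 /\ exists2 xi, U xi & x \in val xi].

Definition pinterior U : set pspace :=
  [set xi : pspace | exists W, [/\ popen W, W `<=` U & W xi]].

Variable B : 'M[R]_n.+1.

Definition bform (x y : V) : R := (x *m B *m y^T) 0 0.

Definition pseudo_hyperbolic : set pspace :=
  [set xi : pspace | forall x, x \in val xi -> x != 0 -> bform x x < 0].

Definition line_orth xi eta : Prop :=
  forall x y, x \in val xi -> y \in val eta -> bform x y = 0.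

(* Only the values of a lift s on the finite set L are relevant. *)
Section Lift.
Variables (L : {fset pspace}) (s : pspace -> V).

Definition is_lift : Prop :=
  forall xi, xi \in L -> s xi \in val xi /\ s xi != 0.

Definition conv_coeff (t : pspace -> R) : Prop :=
  (forall xi, xi \in L -> 0 <= t xi) /\ \sum_(xi <- L) t xi = 1.

Definition conv_lift : set V :=
  [set x | exists2 t, conv_coeff t & x = \sum_(xi <- L) t xi *: s xi].

Definition positive_lift : Prop :=
  [/\ is_lift, ~ conv_lift 0 &
    forall xi eta, xi \in L -> eta \in L -> bform (s xi) (s eta) <= 0].

(* Conv(s): interior of the projection of the convex hull of s(L) to P(V). *)
Definition pconv : set pspace := pinterior (pimage conv_lift).

(* xi is not a non-trivial convex combination of the points of L: if a convex
   combination of the vectors s(eta) lies on the line xi, it only involves xi. *)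
Definition extremal xi : Prop :=
  forall t, conv_coeff t -> \sum_(eta <- L) t eta *: s eta \in val xi ->
    forall eta, eta \in L -> eta != xi -> t eta = 0.

End Lift.

Definition polytope (L : {fset pspace}) : Prop :=
  exists2 s, positive_lift L s & forall xi, xi \in L -> extremal L s xi.

Definition simplex (L : {fset pspace}) : Prop :=
  [/\ polytope L, #|` L|%fset = n.+1 & (\sum_(xi <- L) val xi)%VS = fullv].

(* Adjacency in the graph G(L); a loop at xi means that xi is not isotropic. *)
Definition adjacent xi eta : Prop := ~ line_orth xi eta.

Definition graph_boundary (L I : {fset pspace}) : {fset pspace} :=
  [fset eta in L | (eta \notin I) &&
     `[< exists2 xi, xi \in I & adjacent xi eta >] ]%fset.

Definition stable (I : {fset pspace}) : Prop :=
  forall xi eta, xi \in I -> eta \in I -> ~ adjacent xi eta.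

(* The affine chart of P(R^(n+1)) given by homogeneous coordinates (1 : y). *)
Definition affine_chart (y : 'rV[R]_n) : V := row_mx (const_mx 1 : 'rV[R]_1) y.

(* The representative of (1 : y) in the hyperboloid b(x,x) = -1. *)
Definition hyperboloid_chart (y : 'rV[R]_n) : V :=
  (Num.sqrt (- bform (affine_chart y) (affine_chart y)))^-1 *: affine_chart y.

(* Gram matrix of the pseudo-Riemannian metric: b restricted to the tangent
   spaces of the hyperboloid, pulled back by the chart. *)
Definition metric_mx (y : 'rV[R]_n) : 'M[R]_n :=
  \matrix_(i, j) bform ('D_(delta_mx 0 i) hyperboloid_chart y)
                       ('D_(delta_mx 0 j) hyperboloid_chart y).

Definition affine_trace U : set (n.-tuple (measurableTypeR R)) :=
  [set y | exists2 xi : pspace,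
     (U `&` pseudo_hyperbolic) xi & affine_chart (\row_i tnth y i) \in val xi].

(* The pseudo-Riemannian volume |det g|^(1/2) dy, computed in the affine chart,
   which misses only a projective hyperplane, a set of measure zero. *)
Definition hvolume U : \bar R :=
  (\int[lebesgue_tuple n]_(y in affine_trace U)
     (Num.sqrt `|\det (metric_mx (\row_i tnth y i))|)%:E)%E.

End Form.

(* The rows of P form a b-orthogonal basis with p vectors of square 1 and q'
   vectors of square -1. *)
Definition has_signature (p q' n : nat) (B : 'M[R]_n) : Prop :=
  [/\ (p + q')%N = n, B^T = B &
    exists2 P, P \in unitmx &
      P *m B *m P^T = diag_mx (\row_(i < n) (if (i < p)%N then 1 else -1))].

End PseudoHyperbolic.
Arguments pspace R n : clear implicits.

(* Main.v *)
(* Let v_1, ..., v_d, with d = p + q + 1, be the lifted vertices and A_ij = - b(v_i, v_j),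
   which is nonnegative. In the affine chart the volume density is, up to a constant,
   (- b(x, x))^(- d / 2) at x = (1, y). Integrating radially along the lines through
   the origin, the volume of a projective region is proportional to the Lebesgue
   measure of the part of its cone where - b(x, x) <= 1. In the basis (v_i) the volume
   of the simplex is thus, up to a constant, the measure of
     { t : the t_i are all positive or all negative, sum_ij A_ij t_i t_j <= 1 },
   which is sandwiched between two regions of the form t_i t_j <= C for all edges ij.
   If I is stable with |I| >= |bd I|, such a region contains infinitely many disjoint
   boxes of volume bounded below, obtained by scaling t by 2^m on I and by 2^-m on bd I.
   Otherwise u_i = ln (|t_i| / sqrt C) satisfies sum_i u_i <= - max_i |u_i|, so that the
   indicator of the region is at most a product of the one-variable functions
   exp (- u_i - |u_i| / d), each of which has a finite integral. *)
Require Import Defs.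
From mathcomp Require Import all_boot all_order all_algebra finmap.
From mathcomp Require Import all_classical all_reals all_analysis.
From mathcomp Require Import measurable_realfun ring lra.
Set Implicit Arguments.
Unset Strict Implicit.
Unset Printing Implicit Defensive.
Import Order.TTheory GRing.Theory Num.Theory.
Import numFieldNormedType.Exports.
Local Open Scope classical_set_scope.
Local Open Scope ring_scope.

(** * Lebesgue measure on R^n *)

Section Affine1.
Context {R : realType}.
Local Notation RR := (measurableTypeR R).
Local Notation mu := (@lebesgue_measure R).

Lemma measurable_affine (a b : R) :
  measurable_fun [set: RR] ((fun x => a * x + b) : RR -> RR).
Proof. by apply: measurable_funD => //; exact: measurable_funM. Qed.

(** Both sides are measures in [A], so by uniqueness of Lebesgue measure it suffices to compare them
    on half-open intervals. For [a < 0] the preimage is closed on the left instead of on the right,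
    which does not affect its length. *)
Lemma lebesgue_measure_affine (a b : R) (A : set RR) : a != 0 -> measurable A ->
  (mu A = `|a|%:E * pushforward mu ((fun x => a * x + b)%R : RR -> RR) A)%E.
Proof.
move=> a0 mA.
have na : 0 <= `|a| by [].
pose nu_ : {measure set RR -> \bar R} :=
  mscale (NngNum na) (pushforward mu ((fun x => a * x + b) : RR -> RR)).
pose nu := nu_ (measurable_affine a b).
rewrite (_ : (_ * _)%E = nu A); last by [].
apply: lebesgue_measure_unique mA => _ [[c d] _ <-].
rewrite /nu /nu_ /= /mscale /=.
rewrite [X in (_ * X)%E](_ : _ =
  mu ((fun x => a * x + b) @^-1` `]c, d]%classic)); last by [].
have [a1|a1] := ltP 0 a.
  rewrite (_ : _ @^-1` _ = `](c - b) / a, (d - b) / a]%classic); last first.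
    apply/seteqP; split => x /=; rewrite !in_itv /= ltr_pdivrMr// ler_pdivlMr//.
      by rewrite ltrBlDr lerBrDr mulrC.
    by rewrite ltrBlDr lerBrDr (mulrC x).
  rewrite !lebesgue_measure_itv/= !lte_fin gtr0_norm//.
  rewrite ltr_pM2r ?invr_gt0// ltrD2r; case: ifPn => cd; last by rewrite mule0.
  by rewrite -!EFinB -EFinM; congr EFin; field.
have {}a1 : a < 0 by rewrite lt_neqAle a0.
rewrite (_ : _ @^-1` _ = `[(d - b) / a, (c - b) / a[%classic); last first.
  apply/seteqP; split => x /=; rewrite !in_itv /= ltr_ndivlMr// ler_ndivrMr//.
    by rewrite ltrBlDr lerBrDr mulrC andbC.
  by rewrite ltrBlDr lerBrDr (mulrC x) andbC.
rewrite !lebesgue_measure_itv/= !lte_fin ltr0_norm//.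
rewrite ltr_nM2r ?invr_lt0// ltrD2r; case: ifPn => cd; last by rewrite mule0.
by rewrite -!EFinB -EFinM; congr EFin; field.
Qed.

Lemma ge0_integral_affine (a b : R) (f : RR -> \bar R) : a != 0 ->
  measurable_fun setT f -> (forall x, 0 <= f x)%E ->
  (`|a|%:E * \int[mu]_x f (a * x + b)%R = \int[mu]_x f x)%E.
Proof.
move=> a0 mf f0.
have na : 0 <= `|a| by [].
pose h : RR -> RR := fun x => a * x + b.
have mh : measurable_fun setT h by exact: measurable_affine.
pose nu_ : {measure set RR -> \bar R} :=
  mscale (NngNum na) (pushforward mu h).
pose nu := nu_ mh.
rewrite [RHS](eq_measure_integral nu); last first.
  move=> A mA _. exact: (lebesgue_measure_affine b a0 mA).
rewrite ge0_integral_mscale//= ge0_integral_pushforward//.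
Qed.

End Affine1.

(** * Row vectors as tuples, and Tonelli's theorem *)

Section RowVectors.
Context {R : realType}.
Local Notation RR := (measurableTypeR R).
Local Notation mu := (@lebesgue_measure R).
Local Notation lt := (@lebesgue_tuple R).

Definition vec n (t : n.-tuple RR) : 'rV[R]_n := \row_i tnth t i.
Definition tup n (v : 'rV[R]_n) : n.-tuple RR := [tuple v 0 i | i < n].

Lemma tupK n : cancel (@tup n) (@vec n).
Proof. by move=> v; apply/rowP => i; rewrite mxE tnth_mktuple. Qed.

(** Measurability on row vectors is tested through tuples, which carry the product sigma-algebra,
    while linear algebra is done on row vectors. *)
Definition measurable_rv n (f : 'rV[R]_n -> \bar R) :=
  measurable_fun [set: n.-tuple RR] (f \o @vec n).

Lemma measurable_rv_comp d (T : measurableType d) n (f : 'rV[R]_n -> \bar R)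
    (g : T -> 'rV[R]_n) : measurable_rv f ->
  (forall j, measurable_fun setT ((fun x => g x 0 j) : T -> RR)) ->
  measurable_fun setT (fun x => f (g x)).
Proof.
move=> mf mg.
rewrite (_ : (fun x => f (g x)) = (f \o @vec n) \o (@tup n \o g)); last first.
  by apply/funext => x /=; rewrite tupK.
apply: measurableT_comp => //; apply/measurable_fun_tnthP => i.
rewrite (_ : _ \o _ = (fun x => g x 0 i))//.
by apply/funext => x /=; rewrite tnth_mktuple.
Qed.

Lemma measurable_vec n (j : 'I_n) :
  measurable_fun setT ((fun t => vec t 0 j) : n.-tuple RR -> RR).
Proof.
rewrite (_ : (fun t => _) = (@tnth n RR ^~ j)); last first.
  by apply/funext => t; rewrite mxE.
exact: measurable_tnth.
Qed.

Lemma measurable_vec_mulmx n m (M : 'M[R]_(n, m)) (j : 'I_m) :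
  measurable_fun setT ((fun t => (vec t *m M) 0 j) : n.-tuple RR -> RR).
Proof.
rewrite (_ : (fun t => _) = (fun t : n.-tuple RR => \sum_i vec t 0 i * M i j)).
  apply: measurable_sum => i; apply: measurable_funM => //.
  exact: measurable_vec.
by apply/funext => t; rewrite mxE.
Qed.

(** For [x = 1] this is convertible with [affine_chart v], which later links integrals over slices
    to the volume in the chart. *)
Definition consrv n (x : R) (v : 'rV[R]_n) : 'rV[R]_n.+1 :=
  row_mx (const_mx x : 'rV[R]_1) v.

Lemma vec_tcons n x (t : n.-tuple RR) : vec (tcons (x, t)) = consrv x (vec t).
Proof.
apply/rowP => i; rewrite !mxE; case: splitP => j ij.
  rewrite mxE (_ : i = ord0) ?tnth0//.
  by apply/val_inj => /=; rewrite ij; case: j {ij} => -[].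
rewrite mxE (_ : i = lift ord0 j) ?tnthS//; last exact/val_inj.
Qed.

Section Tonelli.
Variables (n : nat) (f : 'rV[R]_n.+1 -> \bar R).
Hypotheses (mf : measurable_rv f) (f0 : forall v, (0 <= f v)%E).

Lemma measurable_consrv :
  measurable_fun setT (fun z : RR * n.-tuple RR => f (consrv z.1 (vec z.2))).
Proof.
rewrite (_ : (fun z => _) = (f \o @vec n.+1) \o (@tcons R n)); last first.
  by apply/funext => -[x t] /=; rewrite vec_tcons.
by apply: measurableT_comp => //; exact: measurable_tcons.
Qed.

Lemma integral_consrv_prod :
  (\int[lt n.+1]_t f (vec t) =
   \int[mu \x lt n]_z f (consrv z.1 (vec z.2)))%E.
Proof.
(* By construction [lebesgue_tuple n.+1] is this pushforward. *)
transitivity (\int[pushforward (mu \x lt n)%E (@tcons R n)]_t f (vec t))%E.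
  by [].
rewrite ge0_integral_pushforward//.
  by apply: eq_integral => -[x t] _ /=; rewrite vec_tcons.
exact: measurable_tcons.
Qed.

Lemma integral_consrv1 :
  (\int[lt n.+1]_t f (vec t) =
   \int[mu]_x \int[lt n]_t f (consrv x (vec t)))%E.
Proof.
rewrite integral_consrv_prod fubini_tonelli1//.
exact: measurable_consrv.
Qed.

Lemma integral_consrv2 :
  (\int[lt n.+1]_t f (vec t) =
   \int[lt n]_t \int[mu]_x f (consrv x (vec t)))%E.
Proof.
rewrite integral_consrv_prod fubini_tonelli2//.
exact: measurable_consrv.
Qed.

End Tonelli.

End RowVectors.

(** * Linear changes of variables *)

Section LinearChange.
Context {R : realType}.
Local Notation RR := (measurableTypeR R).
Local Notation mu := (@lebesgue_measure R).
Local Notation lt := (@lebesgue_tuple R).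

Lemma consrvD n (x y : R) (v w : 'rV[R]_n) :
  consrv x v + consrv y w = consrv (x + y) (v + w).
Proof. by apply/rowP => i; rewrite !mxE; case: splitP => j _; rewrite !mxE. Qed.

Lemma consrvE n (u : 'rV[R]_n.+1) :
  u = consrv (u 0 0) (rsubmx (u : 'rV_(1 + n))).
Proof.
apply/rowP => i; rewrite mxE; case: splitP => j ij; rewrite !mxE.
  by congr (u _ _); apply/val_inj => /=; rewrite [LHS]ij ord1.
by congr (u _ _); exact/val_inj.
Qed.

Lemma consrv0 n x (v : 'rV[R]_n) : consrv x v 0 0 = x.
Proof. by rewrite mxE; case: splitP => // j _; rewrite mxE. Qed.

Lemma consrv_lift n x (v : 'rV[R]_n) j : consrv x v 0 (lift 0 j) = v 0 j.
Proof.
rewrite mxE; case: splitP => [[[] //]|k /eqP].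
by rewrite eqSS => /eqP/val_inj ->.
Qed.

Lemma measurable_consrv_coord d (T : measurableType d) n (f : T -> R)
    (g : T -> 'rV[R]_n) (j : 'I_n.+1) :
  measurable_fun setT (f : T -> RR) ->
  (forall k, measurable_fun setT ((fun x => g x 0 k) : T -> RR)) ->
  measurable_fun setT ((fun x => consrv (f x) (g x) 0 j) : T -> RR).
Proof.
move=> mf mg; case: (unliftP 0 j) => [k ->|->].
  by under eq_fun do rewrite consrv_lift; exact: mg.
by under eq_fun do rewrite consrv0.
Qed.

Lemma measurable_rv_consrv n (f : 'rV[R]_n.+1 -> \bar R) x :
  measurable_rv f -> measurable_rv (fun v => f (consrv x v)).
Proof.
move=> mf; apply: (measurable_rv_comp (g := fun t => consrv x (vec t)) mf) => j.
by apply: measurable_consrv_coord => // k; exact: measurable_vec.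
Qed.

Lemma measurable_rvD n (f : 'rV[R]_n -> \bar R) w :
  measurable_rv f -> measurable_rv (fun v => f (w + v)).
Proof.
move=> mf; apply: (measurable_rv_comp (g := fun t => w + vec t) mf) => j.
under eq_fun do rewrite mxE.
by apply: measurable_funD => //; exact: measurable_vec.
Qed.

Lemma measurable_rvM n m (f : 'rV[R]_m -> \bar R) (M : 'M[R]_(n, m)) :
  measurable_rv f -> measurable_rv (fun v => f (v *m M)).
Proof.
move=> mf; apply: (measurable_rv_comp (g := fun t => vec t *m M) mf) => j.
exact: measurable_vec_mulmx.
Qed.

Lemma measurable_integral_consrv n (f : 'rV[R]_n.+1 -> \bar R) :
  measurable_rv f -> (forall v, 0 <= f v)%E ->
  measurable_fun setT (fun x : RR => \int[lt n]_t f (consrv x (vec t)))%E.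
Proof.
move=> mf f0.
have := @measurable_fun_fubini_tonelli_F _ _ _ _ R (lt n) _ (measurable_consrv mf).
exact.
Qed.

(** Induction on the dimension: Tonelli splits off the first coordinate, where the one-dimensional
    affine change of variables applies. *)
Lemma integral_translate n (w : 'rV[R]_n) (f : 'rV[R]_n -> \bar R) :
  measurable_rv f -> (forall v, 0 <= f v)%E ->
  (\int[lt n]_t f (w + vec t)%R = \int[lt n]_t f (vec t))%E.
Proof.
elim: n w f => [|n IH] w f mf f0.
  by apply: eq_integral => t _; congr f; apply/rowP => -[].
rewrite (integral_consrv1 (f := fun v => f (w + v)))//; last exact: measurable_rvD.
rewrite (consrvE w); set y := w 0 0; set z := rsubmx _.
under eq_integral => x _.
  under eq_integral do rewrite consrvD.
  rewrite (IH z (fun v => f (consrv (y + x) v)))//; last exact: measurable_rv_consrv.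
  over.
rewrite [RHS](integral_consrv1 mf f0).
rewrite -(ge0_integral_affine y (oner_neq0 R))//=.
- rewrite normr1 mul1e; apply: eq_integral => x _.
  by under [RHS]eq_integral do rewrite mul1r addrC.
- exact: measurable_integral_consrv.
- by move=> x; exact: integral_ge0.
Qed.

(** The linear change of variables formula for [M], with the determinant kept as a factor so that no
    division in the extended reals occurs. *)
Definition scales n (M : 'M[R]_n) := forall f,
  measurable_rv f -> (forall v, 0 <= f v)%E ->
  (`|\det M|%:E * \int[lt n]_t f (vec t *m M) = \int[lt n]_t f (vec t))%E.

Lemma scalesM n (M N : 'M[R]_n) : scales M -> scales N -> scales (M *m N).
Proof.
move=> sM sN f mf f0; rewrite -(sN f)// -(sM (fun v => f (v *m N)))//; last first.
  exact: measurable_rvM.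
rewrite muleA -EFinM -normrM det_mulmx mulrC; congr (_ * _)%E.
by apply: eq_integral => t _; rewrite mulmxA.
Qed.

(** For a fixed first coordinate [x] the map acts on the tail by [N] followed by the translation by
    [x *: w]; the first coordinate itself is multiplied by [a]. *)
Lemma scales_ublock n a (w : 'rV[R]_n) (N : 'M[R]_n) :
  a != 0 -> scales N -> scales (block_mx a%:M w 0 N : 'M[R]_n.+1).
Proof.
move=> a0 sN f mf f0; set M := block_mx _ _ _ _.
have ME x v : consrv x v *m M = consrv (a * x) (x *: w + v *m N).
  rewrite /consrv (@mul_row_block _ 1 1 n 1 n) mulmx0 addr0; congr row_mx.
    by rewrite mul_mx_scalar; apply/rowP => i; rewrite !mxE.
  by congr (_ + _); apply/rowP => i; rewrite !mxE big_ord1 !mxE.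
rewrite (@det_ublock _ 1) det_scalar1.
rewrite (integral_consrv1 (f := fun v => f (v *m M)))//; last exact: measurable_rvM.
rewrite normrM EFinM -muleA -ge0_integralZl_EFin//; last 2 first.
- by move=> x _; exact: integral_ge0.
- exact: (measurable_integral_consrv (measurable_rvM _ mf)).
under eq_integral => x _.
  under eq_integral do rewrite ME.
  rewrite (sN (fun v => f (consrv (a * x) (x *: w + v)))); last 2 first.
  - exact: (measurable_rvD (f := fun v => f (consrv (a * x) v)) _
      (measurable_rv_consrv _ mf)).
  - by move=> v.
  rewrite (integral_translate _ (f := fun v => f (consrv (a * x) v)))//; last first.
    exact: measurable_rv_consrv.
  over.
rewrite [RHS](integral_consrv1 mf f0).
rewrite -[RHS](ge0_integral_affine 0 a0).
- apply: (congr1 (mule _)); apply: eq_integral => x _.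
  by under [RHS]eq_integral do rewrite addr0.
- exact: measurable_integral_consrv.
- by move=> x; exact: integral_ge0.
Qed.

(** For a fixed tail this shear only translates the first coordinate, so Tonelli is used with the
    first coordinate innermost. *)
Lemma scales_lblock n (c : 'cV[R]_n) :
  scales (block_mx 1%:M 0 c 1%:M : 'M[R]_n.+1).
Proof.
move=> f mf f0; set M := block_mx _ _ _ _.
have ME x v : consrv x v *m M = consrv (1 * x + (v *m c) 0 0) v.
  rewrite /consrv (@mul_row_block _ 1 1 n 1 n) mulmx0 add0r !mulmx1 mul1r; congr row_mx.
  by apply/rowP => i; rewrite !mxE ord1; congr (_ + _).
rewrite (@det_lblock _ 1) !det1 mulr1 normr1 mul1e.
rewrite (integral_consrv2 (f := fun v => f (v *m M)))//; last exact: measurable_rvM.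
under eq_integral => t _.
  under eq_integral do rewrite ME.
  have := ge0_integral_affine ((vec t *m c) 0 0)
    (f := fun x => f (consrv x (vec t))) (oner_neq0 R).
  rewrite normr1 mul1e => ->//; first over.
  apply: (measurable_rv_comp (g := fun x => consrv x (vec t)) mf) => j.
  exact: measurable_consrv_coord.
by rewrite [RHS]integral_consrv2.
Qed.

(** Induction on the size through a block LU factorisation, after a shear that makes the corner
    entry nonzero if necessary. *)
Lemma scales_unitmx n (M : 'M[R]_n) : M \in unitmx -> scales M.
Proof.
elim: n M => [|n IH] M uM.
  move=> f mf f0; rewrite det_mx00 normr1 mul1e.
  by apply: eq_integral => t _; congr f; apply/rowP => -[].
(* With a nonzero corner, [N] is a shear times a block upper triangular matrix whose lower block is
   the Schur complement, invertible because [N] is. *)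
have lu (N : 'M[R]_(1 + n)) : ulsubmx N 0 0 != 0 -> N \in unitmx -> scales N.
  set a := ulsubmx N 0 0 => a0 uN.
  have NE : N = block_mx 1%:M 0 (a^-1 *: dlsubmx N) 1%:M *m
      block_mx a%:M (ursubmx N) 0 (drsubmx N - a^-1 *: dlsubmx N *m ursubmx N).
    rewrite mulmx_block !mul1mx !mul0mx !addr0 mul_mx_scalar scalerA mulfV//.
    rewrite scale1r addrC subrK.
    rewrite -[LHS]submxK; congr block_mx.
    exact: mx11_scalar.
  move: NE; set N' := drsubmx N - _; set c := _ *: _; set w := ursubmx N.
  move: N' c w => N' c w NE; rewrite NE.
  apply: scalesM; first exact: scales_lblock.
  apply: scales_ublock => //; apply: IH.
  move: uN; rewrite unitmxE NE det_mulmx det_lblock !det1 !mul1r.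
  by rewrite det_ublock unitrM => /andP[].
have [a0|a0] := eqVneq (ulsubmx (M : 'M[R]_(1 + n)) 0 0) 0; last exact: lu.
(* With corner 0, multiplying by the shear [L w^T] turns the corner into the squared norm of [w],
   which is nonzero since the first row of [M] is. *)
pose w := ursubmx (M : 'M[R]_(1 + n)).
pose L (c : 'cV[R]_n) : 'M[R]_(1 + n) := block_mx 1%:M 0 c 1%:M.
have LK : L w^T *m L (- w^T) = 1%:M.
  rewrite mulmx_block !mul1mx !mul0mx !mulmx0 !mulmx1 !addr0 add0r subrr.
  by rewrite -scalar_mx_block.
rewrite -[M]mulmx1 -LK mulmxA; apply: scalesM; last exact: scales_lblock.
apply: lu; last by rewrite unitmx_mul uM; case/mulmx1_unit: LK.
have -> : ulsubmx ((M : 'M[R]_(1 + n)) *m L w^T) = ulsubmx (M : 'M[R]_(1 + n)) + w *m w^T.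
  by rewrite -[X in X *m _](@submxK _ 1 n 1 n) mulmx_block block_mxKul mulmx1.
rewrite mxE a0 add0r mxE psumr_neq0; last first.
  by move=> i _; rewrite [X in _ * X]mxE -expr2 sqr_ge0.
apply/hasP; have [w0|] := eqVneq w 0.
  suff M0 : row 0 M = 0.
    have : row 0 M *m invmx M = 0 by rewrite M0 mul0mx.
    rewrite -row_mul mulmxV// => /rowP /(_ 0); rewrite !mxE => /eqP.
    by rewrite oner_eq0.
  rewrite (consrvE (row 0 M)); apply/rowP => i; rewrite !mxE.
  case: splitP => j _; rewrite !mxE.
    by move: a0; rewrite !mxE lshift0.
  by move/rowP : w0 => /(_ j); rewrite !mxE; apply: etrans; congr (M _ _); exact/val_inj.
move=> /rV0Pn[i wi]; exists i; first by rewrite mem_index_enum.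
by rewrite /= [X in _ * X]mxE -expr2 exprn_even_gt0.
Qed.

End LinearChange.

(** * Radial integration over cones *)

Section Cone.
Context {R : realType}.
Local Notation RR := (measurableTypeR R).
Local Notation mu := (@lebesgue_measure R).
Local Notation lt := (@lebesgue_tuple R).

(** The value is 2 / (n + 1), but only its positivity and finiteness matter below. The origin is
    excluded to match the cones, which do not contain 0. *)
Definition radial_cst n : \bar R :=
  (\int[mu]_r (`|r| ^+ n * ((r != 0) && (`|r| <= 1)%R)%:R)%:E)%E.

Lemma measurable_radial n : measurable_fun setT
  ((fun r => `|r| ^+ n * ((r != 0) && (`|r| <= 1))%:R) : RR -> R).
Proof.
apply: measurable_funM.
  by apply: measurable_funX; exact: normr_measurable.
rewrite (_ : (fun r : R => _) = \1_(`[-1, 1] `\ 0)).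
  apply: measurable_indic; apply: measurableD; first exact: measurable_itv.
  exact: measurable_set1.
apply/funext => r; rewrite indicE; congr (_%:R); congr nat_of_bool.
apply/idP/idP.
  move=> /andP[r0 r1]; rewrite inE; split => /=; last exact/eqP.
  by rewrite in_itv/= -ler_norml.
by rewrite inE => -[/=]; rewrite in_itv/= -ler_norml => -> /eqP ->.
Qed.

(** The integrand is at least 2^-n on [1/2, 1]. *)
Lemma radial_cst_gt0 n : (0 < radial_cst n)%E.
Proof.
have h0 : 0 <= (2^-1 : R) ^+ n by rewrite exprn_ge0// invr_ge0.
have h : (0 < \int[mu]_(r in `[2^-1%R, 1%R]%classic) ((2^-1 : R) ^+ n)%:E)%E.
  rewrite integral_cst//= lebesgue_measure_itv/= lte_fin invf_lt1// ltr1n.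
  rewrite -EFinB -EFinM lte_fin mulr_gt0 ?exprn_gt0 ?invr_gt0//.
  by rewrite subr_gt0 invf_lt1 ?ltr1n.
apply: (lt_le_trans h).
rewrite integral_mkcond; apply: ge0_le_integral => //.
- by move=> r _; apply: erestrict_ge0 => ? _; rewrite lee_fin.
- by apply/measurable_restrict => //; exact: measurable_cst.
- by apply/measurable_EFinP; exact: measurable_radial.
- move=> r _; rewrite patchE; case: ifPn; last first.
    by move=> _; rewrite lee_fin mulr_ge0// exprn_ge0.
  rewrite inE /= in_itv/= => /andP[r1 r2].
  have r0 : 0 < r by rewrite (lt_le_trans _ r1)// invr_gt0.
  by rewrite gt_eqF//= gtr0_norm// r2 mulr1 lee_fin lerXn2r// nnegrE ?invr_ge0 ?ltW.
Qed.

Lemma radial_cst_lty n : (radial_cst n < +oo)%E.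
Proof.
have h : (\int[mu]_(r in `[(-1)%R, 1%R]%classic) (1 : R)%:E < +oo)%E.
  rewrite integral_cst//= lebesgue_measure_itv/= mul1e lte_fin.
  by case: ifP; rewrite ?ltry.
apply: le_lt_trans h; rewrite [leRHS]integral_mkcond; apply: ge0_le_integral => //.
- by apply/measurable_EFinP; exact: measurable_radial.
- by apply/measurable_restrict => //; exact: measurable_cst.
- move=> r _; rewrite patchE mem_setE.
  rewrite in_itv/= -ler_norml; case: ifPn => r1; last by rewrite andbF mulr0.
  rewrite lee_fin; case: (r != 0); rewrite ?mulr0// mulr1.
  exact: exprn_ile1.
Qed.

Lemma radial_cst_fin n : exists2 c : R, 0 < c & radial_cst n = c%:E.
Proof.
have cE : radial_cst n = (fine (radial_cst n))%:E.
  by rewrite fineK// ge0_fin_numE ?radial_cst_lty// ltW// radial_cst_gt0.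
by exists (fine (radial_cst n)) => //; rewrite -lte_fin -cE radial_cst_gt0.
Qed.

Variables (n : nat) (K : set 'rV[R]_n.+1) (Q : 'rV[R]_n.+1 -> R).
Hypothesis KZ : forall (r : R) (u : 'rV[R]_n.+1), r != 0 -> K (r *: u) <-> K u.
Hypothesis QZ : forall (r : R) (u : 'rV[R]_n.+1), Q (r *: u) = r ^+ 2 * Q u.
Hypothesis Q_gt0 : forall u, K u -> 0 < Q u.
Let S := [set u | K u /\ Q u <= 1].
Hypothesis mS : measurable_rv (fun v => (\1_S v : R)%:E).

(** For [u] in [K], the multiple [r *: u] lies in [S] exactly when 0 < |a r| <= 1, where a = sqrt (Q
    u). Substituting a r for r gives a factor a^-n from the weight and a^-1 from the measure. *)
Let radial_integral (u : 'rV[R]_n.+1) :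
  (\int[mu]_r (`|r| ^+ n * \1_S (r *: u))%:E =
   radial_cst n * (\1_K u * (Num.sqrt (Q u)) ^- n.+1)%:E)%E.
Proof.
have K0 : ~ K 0.
  by move=> /Q_gt0; have := QZ 0 0; rewrite scale0r expr0n mul0r => ->; rewrite ltxx.
rewrite indicE; case: (boolP (u \in K)); rewrite ?inE ?notin_setE => Ku.
  have Qu := Q_gt0 Ku; set a := Num.sqrt (Q u).
  have a0 : 0 < a by rewrite sqrtr_gt0.
  have aE : a ^+ 2 = Q u by rewrite sqr_sqrtr// ltW.
  have ai0 : 0 < a^-1 by rewrite invr_gt0.
  have SE r : (\1_S (r *: u) : R) = ((r != 0) && (`|a * r| <= 1))%:R.
    rewrite indicE; congr (_%:R); congr nat_of_bool.
    apply/idP/idP; rewrite inE /S /= QZ -aE -exprMn mulrC.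
      move=> [Kru aru]; apply/andP; split.
        by apply: contra_notT K0 => /negPn/eqP r0; move: Kru; rewrite r0 scale0r.
      by rewrite -(@ler_pXn2r _ 2) ?nnegrE// expr1n real_normK ?num_real.
    move=> /andP[r0 ar]; split; first exact/KZ.
    by rewrite -real_normK ?num_real// exprn_ile1.
  have SE' r : (`|r| ^+ n * \1_S (r *: u) =
      a ^- n * (`|a * r + 0| ^+ n * ((a * r + 0 != 0) && (`|a * r + 0| <= 1))%:R))%R.
    rewrite SE addr0 mulrA mulf_eq0 (gt_eqF a0)/=; congr (_ * _).
    by rewrite normrM exprMn gtr0_norm// mulKf// expf_neq0// gt_eqF.
  under eq_integral do rewrite SE' EFinM.
  rewrite ge0_integralZl_EFin//; last 2 first.
  - apply/measurable_EFinP.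
    exact: (measurableT_comp (measurable_radial n) (measurable_affine a 0)).
  - by rewrite invr_ge0 exprn_ge0// ltW.
  rewrite /radial_cst; have <- := @ge0_integral_affine _ a 0
    (fun r => (`|r| ^+ n * ((r != 0) && (`|r| <= 1)%R)%:R)%:E) (lt0r_neq0 a0).
  - rewrite mul1r gtr0_norm// [RHS]muleC muleA -EFinM; congr (_ * _)%E.
    by rewrite exprS invfM mulrAC mulVf ?gt_eqF// mul1r.
  - by apply/measurable_EFinP; exact: measurable_radial.
  - by move=> r; rewrite lee_fin mulr_ge0// exprn_ge0.
rewrite mul0r mule0; apply: integral0_eq => r _.
rewrite indicE; suff -> : (r *: u \in S) = false by rewrite mulr0.
apply/negP; rewrite inE => -[Kru _]; have [r0|r0] := eqVneq r 0.
  by move: Kru; rewrite r0 scale0r.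
by apply: Ku; exact: (KZ u r0).1 Kru.
Qed.

Let measurable_homothety :
  measurable_fun setT (fun z : RR * n.-tuple RR =>
    (`|z.1| ^+ n * \1_S (z.1 *: consrv 1 (vec z.2)))%:E).
Proof.
under eq_fun do rewrite EFinM.
apply: emeasurable_funM.
  apply/measurable_EFinP; apply: measurable_funX.
  by apply: measurableT_comp => //; exact: normr_measurable.
have := (@measurable_rv_comp R _ (RR * n.-tuple RR)%type _ _
  (fun z => z.1 *: consrv 1 (vec z.2)) mS); apply => j.
under eq_fun do rewrite mxE.
apply: measurable_funM => //.
apply: measurable_consrv_coord => // k.
by apply: (measurableT_comp (measurable_vec k)).
Qed.

Let homothety_ge0 (z : RR * n.-tuple RR) :
  (0 <= (`|z.1| ^+ n * \1_S (z.1 *: consrv 1 (vec z.2)))%:E)%E.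
Proof. by rewrite lee_fin mulr_ge0 ?exprn_ge0// indicE. Qed.

(* Up to a constant factor, the density is a Fubini marginal of the indicator of S. *)
Lemma measurable_cone_density : measurable_rv (fun v =>
  (\1_K (consrv 1 v) * Num.sqrt (Q (consrv 1 v)) ^- n.+1)%:E).
Proof.
have [c c0 cE] := radial_cst_fin n.
have := @measurable_fun_fubini_tonelli_G _ _ _ _ R mu _ measurable_homothety
  homothety_ge0.
move=> /(measurable_funeM c^-1%:E); apply: eq_measurable_fun => t _.
rewrite /fubini_G.
rewrite (_ : (\int[mu]_x _)%E = \int[mu]_r
  (`|r| ^+ n * \1_S (r *: consrv 1%R (vec t)))%:E)%E; last by [].
by rewrite radial_integral cE muleA -(EFinM c^-1 c) mulVf ?gt_eqF// mul1e.
Qed.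

(** Slice by the first coordinate r, substitute t by r t inside each slice, which produces the
    weight |r|^n, then exchange the integrals and integrate along lines. *)
Lemma integral_cone :
  (\int[lt n.+1]_t (\1_S (vec t))%:E =
   radial_cst n * \int[lt n]_t
     (\1_K (consrv 1%R (vec t)) * (Num.sqrt (Q (consrv 1%R (vec t)))) ^- n.+1)%:E)%E.
Proof.
have f0 v : (0 <= (\1_S v : R)%:E)%E by rewrite lee_fin indicE.
have mT0 : measurable ([set: RR] `\ 0).
  by apply: measurableD; [exact: measurableT|exact: measurable_set1].
rewrite (integral_consrv1 mS f0).
(* The slice at r = 0 has to be removed, since the homothety of ratio r is not invertible there; it
   is negligible. *)
transitivity (\int[mu]_(r in setT `\ 0%R)
    \int[lt n]_t (`|r| ^+ n * \1_S (r *: consrv 1%R (vec t)))%:E)%E.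
  rewrite -(integral_setD1 mT0); last first.
    exact: (measurable_funTS (measurable_integral_consrv mS f0)).
  apply: eq_integral => r; rewrite inE => -[_ /eqP r0].
  have uM : (r%:M : 'M[R]_n) \in unitmx by rewrite unitmxE det_scalar unitrX// unitfE.
  rewrite -(scales_unitmx uM (measurable_rv_consrv r mS))//.
  rewrite det_scalar normrX -ge0_integralZl_EFin//; last first.
    exact: (measurable_rvM r%:M (measurable_rv_consrv r mS)).
  apply: eq_integral => t _; rewrite EFinM; congr (_ * (\1_S _)%:E)%E.
  by apply/rowP => i; rewrite mul_mx_scalar !mxE; case: splitP => j _; rewrite !mxE ?mulr1.
rewrite (integral_setD1 mT0); last first.
  apply: measurable_funTS.
  exact: (@measurable_fun_fubini_tonelli_F _ _ _ _ R (lt n) _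
    measurable_homothety homothety_ge0).
rewrite (@fubini_tonelli _ _ _ _ R mu (lt n) _ measurable_homothety homothety_ge0).
under eq_integral => t _.
  rewrite (_ : (\int[mu]_x _)%E = \int[mu]_r
    (`|r| ^+ n * \1_S (r *: consrv 1%R (vec t)))%:E)%E; last by [].
  rewrite radial_integral; over.
have [c c0 cE] := radial_cst_fin n.
rewrite cE ge0_integralZl_EFin//; last exact: ltW.
exact: measurable_cone_density.
Qed.

End Cone.

(** * The volume density of the pseudo-Riemannian metric *)

Section Metric.
Context {R : realType} {n : nat}.
Variable B : 'M[R]_n.+1.
Hypothesis symB : B^T = B.
Local Notation b := (bform B).
Local Notation chart := (@affine_chart R n).

Lemma bformC x y : b x y = b y x.
Proof.
rewrite /bform -[in LHS](trmxK (x *m B *m y^T)) [LHS]mxE.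
by rewrite !trmx_mul trmxK symB mulmxA.
Qed.

Lemma bformDl x y z : b (x + y) z = b x z + b y z.
Proof. by rewrite /bform !mulmxDl mxE. Qed.

Lemma bformZl a x z : b (a *: x) z = a * b x z.
Proof. by rewrite /bform -!scalemxAl mxE. Qed.

Lemma bformDr x y z : b z (x + y) = b z x + b z y.
Proof. by rewrite bformC bformDl !(bformC z). Qed.

Lemma bformZr a x z : b z (a *: x) = a * b z x.
Proof. by rewrite bformC bformZl bformC. Qed.

(** The derivative of [affine_chart] in the direction [v]. *)
Definition tangent (v : 'rV[R]_n) : 'rV[R]_n.+1 := row_mx (0 : 'rV[R]_1) v.

Lemma affine_chartD y v (h : R) :
  chart (h *: v + y) = chart y + h *: tangent v.
Proof.
by apply/rowP => i; rewrite !mxE; case: splitP => j _; rewrite !mxE; ring.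
Qed.

(** The factor that brings [affine_chart y] onto the hyperboloid. *)
Definition lapse y := (Num.sqrt (- b (chart y) (chart y)))^-1.

(** Along a line the quantity under the root is a quadratic polynomial [p] with p'(0) = - 2 b1, and
    the chain rule applies to the inverse of its square root. *)
Lemma lapse_derive y v : 0 < - b (chart y) (chart y) ->
  is_derive (0 : R) 1 (fun h : R => lapse (h *: v + y))
    (lapse y ^+ 3 * b (chart y) (tangent v)).
Proof.
set f0 := - b _ _; set b1 := b _ (tangent v) => f0_gt0.
pose p (h : R) : R := f0 - 2 * b1 * h - b (tangent v) (tangent v) * h ^+ 2.
have pE h : - b (chart (h *: v + y)) (chart (h *: v + y)) = p h.
  rewrite affine_chartD !(bformDl, bformDr, bformZl, bformZr).
  by rewrite (bformC (tangent v)) /p /f0 /b1; ring.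
have p0 : p 0 = f0 by rewrite /p; ring.
have dp : is_derive (0 : R) 1 p (- 2 * b1).
  rewrite /p; apply: is_derive_eq.
  by rewrite /GRing.scale/=; ring.
have ds : is_derive (0 : R) 1 (Num.sqrt \o p) ((2 * Num.sqrt f0)^-1 * (- 2 * b1)).
  have p0_gt0 : 0 < p 0 by rewrite p0.
  have := is_derive1_comp (is_derive1_sqrt p0_gt0) dp.
  by rewrite p0.
have s0 : (Num.sqrt \o p) 0 != 0 by rewrite /= p0 gt_eqF// sqrtr_gt0.
have := is_deriveV s0 ds.
rewrite (_ : (fun h => lapse _) = (fun h => ((Num.sqrt \o p) h)^-1)); last first.
  by apply/funext => h /=; rewrite /lapse pE.
move=> h; apply: (is_derive_eq h).
rewrite /= p0 /lapse -/f0 /GRing.scale/=.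
have : Num.sqrt f0 != 0 by rewrite gt_eqF// sqrtr_gt0.
move: (Num.sqrt f0) => s sn0.
by field.
Qed.

(** The product rule for [lapse] times the affine chart, carried out on difference quotients. *)
Lemma derive_hyperboloid_chart y v : 0 < - b (chart y) (chart y) ->
  'D_v (hyperboloid_chart B) y =
  lapse y *: tangent v +
  (lapse y ^+ 3 * b (chart y) (tangent v)) *: chart y.
Proof.
move=> f_gt0; have [dG GE] := lapse_derive v f_gt0.
set G := fun h : R => lapse (h *: v + y) in dG GE.
have G0 : G 0 = lapse y by rewrite /G scale0r add0r.
apply/cvg_lim => //.
have cG : G h @[h --> 0^'] --> lapse y.
  rewrite -G0; apply: cvg_within_filter.
  exact/differentiable_continuous/derivable1_diffP.
have cD : h^-1 * (G h - G 0) @[h --> 0^'] -->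
    lapse y ^+ 3 * b (chart y) (tangent v).
  rewrite -GE; move: (dG); rewrite /derivable => cdG.
  apply: cvg_trans cdG; apply: near_eq_cvg; near=> h.
  by rewrite /= /shift/= addr0 /GRing.scale/= mulr1.
apply: (@cvg_trans _ ((G h *: tangent v + (h^-1 * (G h - G 0)) *: chart y)
    @[h --> 0^'])).
  apply: near_eq_cvg; near=> h.
  have h0 : h != 0 by near: h; exact: nbhs_dnbhs_neq.
  rewrite /= /hyperboloid_chart -!/(lapse _) -/(G h) G0 affine_chartD.
  rewrite scalerDr mulrBr scalerBl scalerDr scalerN !scalerA.
  rewrite scalerDr !scalerA (_ : h^-1 * (G h * h) = G h); last by field.
  by rewrite addrA [X in X - _]addrC.
by apply: cvgD; apply: cvgZr_tmp.
Unshelve. all: by end_near. Qed.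

Lemma mulmx_bform m (X : 'M[R]_(m, n.+1)) i j :
  (X *m B *m X^T) i j = b (row i X) (row j X).
Proof.
rewrite /bform -row_mul [RHS]mxE [LHS]mxE.
by apply: eq_bigr => k _; rewrite !mxE.
Qed.

(* The frame (h, D_1 h, ..., D_n h) is orthogonal in its first vector and is
   unitriangular, up to scaling by the lapse, over the frame (chart y, e_1, ..., e_n). *)
Lemma det_metric_mx y : 0 < - b (chart y) (chart y) ->
  \det (metric_mx B y) = - \det B * lapse y ^+ n.+1 ^+ 2.
Proof.
move=> f_gt0; set g := lapse y.
have gE : g ^+ 2 * b (chart y) (chart y) = -1.
  rewrite /g /lapse exprVn sqr_sqrtr ?ltW// invrN mulNr mulVf//.
  by rewrite -oppr_eq0 gt_eqF.
pose c : 'cV[R]_n := \col_i (g ^+ 3 * b (chart y) (tangent (delta_mx 0 i))).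
pose D : 'M[R]_(n, 1 + n) := \matrix_i 'D_(delta_mx 0 i) (hyperboloid_chart B) y.
pose X : 'M[R]_(1 + n) := col_mx (g *: chart y : 'rV_(1 + n)) D.
have DE i : row i D =
    g *: tangent (delta_mx 0 i) + c i 0 *: chart y.
  by rewrite rowK derive_hyperboloid_chart// mxE.
have detX : \det X = g ^+ n.+1.
  rewrite (_ : X = block_mx g%:M 0 c g%:M *m
      block_mx 1%:M y 0 1%:M); last first.
    rewrite -[block_mx 1%:M _ _ _]/(col_mx (row_mx 1%:M y) (row_mx 0 1%:M)).
    rewrite mul_block_col mul0mx addr0 /X; congr col_mx.
      rewrite mul_scalar_mx; congr (_ *: row_mx _ _).
      by apply/matrixP => i j; rewrite !ord1 !mxE.
    apply/row_matrixP => i; rewrite DE; apply/rowP => j.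
    rewrite mul_scalar_mx !mxE big_ord1 !mxE.
    by case: splitP => k jk; rewrite !mxE ?ord1 ?eqxx ?(eq_sym i)/=; ring.
  rewrite det_mulmx det_lblock det_ublock !det1 !mulr1 !det_scalar expr1.
  by rewrite -exprS.
have bxD i : b (g *: chart y) (row i D) = 0.
  rewrite DE bformDr !bformZl !bformZr mxE.
  transitivity (g ^+ 2 * b (chart y) (tangent (delta_mx 0 i)) *
    (1 + g ^+ 2 * b (chart y) (chart y))); first by ring.
  by rewrite gE subrr mulr0.
have XBX : X *m B *m X^T = block_mx (- 1)%:M 0 0 (metric_mx B y).
  apply/matrixP => i j; rewrite mulmx_bform.
  case: (@split_ordP 1 n i) => i' ->; case: (@split_ordP 1 n j) => j' ->.
  - rewrite block_mxEul !rowKu !ord1 mxE /=.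
    have -> : row 0 (g *: chart y : 'rV_(1 + n)) = g *: chart y.
      by apply/rowP => k; rewrite !mxE.
    by rewrite bformZl bformZr mulrA -expr2 gE.
  - rewrite block_mxEur rowKu rowKd !ord1 mxE.
    have -> : row 0 (g *: chart y : 'rV_(1 + n)) = g *: chart y.
      by apply/rowP => k; rewrite !mxE.
    exact: bxD.
  - rewrite block_mxEdl rowKu rowKd !ord1 mxE.
    have -> : row 0 (g *: chart y : 'rV_(1 + n)) = g *: chart y.
      by apply/rowP => k; rewrite !mxE.
    by rewrite bformC; exact: bxD.
  - by rewrite block_mxEdr !rowKd mxE !rowK.
(* The Gram determinant of the frame [X] is (det X)^2 det B on one side and minus the determinant of
   the metric on the other. *)
have := congr1 (fun M : 'M[R]_(1 + n) => \det M) XBX.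
rewrite !det_mulmx det_tr detX det_lblock det_scalar1 mulN1r => E.
by rewrite -[LHS]opprK -E; ring.
Qed.

Lemma sqrt_det_metric_mx y : 0 < - b (chart y) (chart y) ->
  Num.sqrt `|\det (metric_mx B y)| =
  Num.sqrt `|\det B| * Num.sqrt (- b (chart y) (chart y)) ^- n.+1.
Proof.
move=> f_gt0; rewrite det_metric_mx// normrM normrN sqrtrM// normrX.
by rewrite sqrtr_sqr normr_id normrX /lapse -exprVn ger0_norm// invr_ge0.
Qed.

End Metric.

(** * The expansion inequality on graphs *)

Section Shaving.
Variables (R : realDomainType) (T : finType) (e : rel T).
Hypothesis esym : symmetric e.

Definition stable_set (I : {set T}) := [forall i in I, forall j in I, ~~ e i j].

Definition boundary_set (I : {set T}) : {set T} :=
  [set j | (j \notin I) && [exists i in I, e i j]]%SET.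

Hypothesis expanding :
  forall I, I != finset.set0 -> stable_set I -> (#|I| < #|boundary_set I|)%N.

(* Lowering u by its smallest positive value on P = {u > 0}, and raising it by
   the same amount on the boundary of P, preserves the edge inequalities. *)
Lemma sum_le_norm (u : T -> R) :
  (forall i j, e i j -> u i + u j <= 0) -> forall k, \sum_i u i <= - `|u k|.
Proof.
(* Induction on the number of positive values of [u]. *)
have [N] := ubnP #|[set i | 0 < u i]%SET|; elim: N u => // N IH u ltN eu k.
set P := [set i | 0 < u i]%SET in ltN.
have inP i : (i \in P) = (0 < u i) by rewrite inE.
have [P0|Pn0] := eqVneq P finset.set0.
  have u_le0 i : u i <= 0 by rewrite leNgt -inP P0 finset.in_set0.
  rewrite ler0_norm// opprK (bigD1 k)//= gerDl.
  by apply: sumr_le0.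
have /set0Pn[p0 p0P] := Pn0.
have [i0 i0P i0min] : exists2 i0, i0 \in P & forall i, i \in P -> u i0 <= u i.
  by case: (arg_minP u p0P) => i0 ? ?; exists i0.
set a := u i0; have a0 : 0 < a by rewrite -inP.
have stP : stable_set P.
  apply/forall_inP => i iP; apply/forall_inP => j jP; apply/negP => /eu.
  by rewrite leNgt addr_gt0// -inP.
have bdP j : j \in boundary_set P -> u j <= - a.
  rewrite inE => /andP[_ /exists_inP[i iP /eu]].
  by rewrite -lerBrDl sub0r => /le_trans; apply; rewrite lerN2 i0min.
have bdPC j : j \in boundary_set P -> j \notin P by rewrite inE => /andP[].
pose u' i := u i - a *+ (i \in P) + a *+ (i \in boundary_set P).
have u'P i : i \in P -> u' i = u i - a.
  move=> iP; rewrite /u' iP (_ : _ \in boundary_set P = false) ?addr0//.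
  by apply/negP => /bdPC; rewrite iP.
have u'bd i : i \in boundary_set P -> u' i = u i + a.
  by move=> ib; rewrite /u' ib (negbTE (bdPC _ ib)) subr0.
have u'0 i : i \notin P -> i \notin boundary_set P -> u' i = u i.
  by move=> /negbTE iP /negbTE ib; rewrite /u' iP ib subr0 addr0.
have u'_le0 i : i \notin P -> u' i <= 0.
  move=> iP; have [ib|ib] := boolP (i \in boundary_set P).
    by rewrite u'bd// -lerBrDr sub0r bdP.
  by rewrite u'0// leNgt -inP.
have eu' i j : e i j -> u' i + u' j <= 0.
  wlog iP : i j / i \in P.
    move=> h eij; have [iP|iP] := boolP (i \in P); first exact: h.
    have [jP|jP] := boolP (j \in P); first by rewrite addrC h// esym.
    by rewrite -[leRHS]addr0 lerD// u'_le0.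
  move=> eij; have jb : j \in boundary_set P.
    rewrite inE; apply/andP; split; last by apply/exists_inP; exists i.
    apply/negP => jP; move/forall_inP : stP => /(_ i iP)/forall_inP/(_ j jP).
    by rewrite eij.
  by rewrite u'P// u'bd// addrACA addNr addr0 eu.
(* The minimiser [i0] leaves the positive set and no vertex enters it. *)
have ltN' : (#|[set i | (0 < u' i)%R]%SET| < N)%N.
  move: ltN; rewrite ltnS; apply: leq_trans; apply: proper_card.
  apply/properP; split; last first.
    by exists i0 => //; rewrite inE u'P// subrr ltxx.
  apply/fintype.subsetP => i; rewrite inE; apply: contraTT => /u'_le0.
  by rewrite -leNgt.
have := IH u' ltN' eu' k.
rewrite /u' big_split sumrB/= !sumrMnr => le1.
have sumP (A : {set T}) : (\sum_i (i \in A : nat))%N = #|A|.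
  by rewrite -sum1_card [RHS]big_mkcond; apply: eq_bigr => i _; case: (i \in A).
move: le1; rewrite (sumP P) (sumP (boundary_set P)) => le1.
(* As the boundary of P has at least |P| + 1 elements, the move raises the sum by at least [a]. This
   pays for the change of |u k|, which is at most [a]. *)
have {}le1 : \sum_i u i <= - `|u' k| - a.
  have : a *+ #|P|.+1 <= a *+ #|boundary_set P|.
    by rewrite (ler_pMn2l a0) expanding.
  rewrite mulrS; move: le1; rewrite -[X in `|X|]/(u' k).
  move: (a *+ _) (a *+ _) => X Y; lra.
apply: (le_trans le1); rewrite -opprD lerN2.
have -> : u k = u' k + (u k - u' k) by rewrite addrC subrK.
rewrite (le_trans (ler_normD _ _))// lerD2l /u'.
have [kP|kP] := boolP (k \in P).
  rewrite (_ : _ \in boundary_set P = false) ?addr0 ?opprB; last first.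
    by apply/negP => /bdPC; rewrite kP.
  by rewrite addrC subrK mulr1n gtr0_norm.
rewrite subr0; case: (k \in _); last by rewrite addr0 subrr normr0 ltW.
by rewrite opprD addrA subrr sub0r normrN mulr1n gtr0_norm.
Qed.

End Shaving.

(** * Lebesgue measure of the region cut out by the edge inequalities *)

Section Kernel.
Context {R : realType}.
Local Notation RR := (measurableTypeR R).
Local Notation mu := (@lebesgue_measure R).
Variable c : R.
Hypothesis c0 : 0 < c.

(* The sigmoid of c ln x. Its derivative is comparable to
   min (x ^ c, x ^ - c) / x, and is integrable since the sigmoid is bounded. *)
Let E (x : R) := expR (- (c * ln x)).
Let H (x : R) := (1 + E x)^-1.
Let kern (x : R) := c * x^-1 * E x * (1 + E x) ^- 2.

Let E_derive (x : R) : 0 < x -> is_derive x 1 E (- (c * x^-1) * E x).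
Proof.
move=> x0; have dln := is_derive1_ln x0.
have dl : is_derive x 1 (fun y : R => - (c * ln y)) (- (c * x^-1)).
  by apply: is_derive_eq.
have := is_derive1_comp (f := expR) (g := fun y => - (c * ln y))
  (is_derive_expR (- (c * ln x))) dl.
by move=> h; apply: (is_derive_eq h); rewrite /E mulrC.
Qed.

Let E1_neq0 x : 1 + E x != 0.
Proof. by rewrite gt_eqF// addr_gt0// expR_gt0. Qed.

Let H_derive (x : R) : 0 < x -> is_derive x 1 H (kern x).
Proof.
move=> x0; have dE := E_derive x0.
have dE1 : is_derive x 1 (fun y : R => 1 + E y) (- (c * x^-1) * E x).
  have := is_deriveD (is_derive_cst (1 : R) x 1) dE.
  by move=> h; apply: (is_derive_eq h); rewrite add0r.
have := is_deriveV (f := fun y : R => 1 + E y) (x := x) (E1_neq0 x) dE1.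
move=> h; apply: (is_derive_eq h); rewrite /kern /GRing.scale/=.
have := E1_neq0 x; move: (E x) => y; rewrite -exprVn => y0.
by rewrite exprVn; field; rewrite y0 gt_eqF.
Qed.

Let kern_derivable (x : R) : 0 < x -> derivable kern x 1.
Proof.
move=> x0; have dE := E_derive x0.
have dE1 : is_derive x 1 (fun y : R => (1 + E y) ^+ 2)
    (2 * (1 + E x) * (- (c * x^-1) * E x)).
  by apply: is_derive_eq; rewrite /GRing.scale/=; ring.
have E2 : (1 + E x) ^+ 2 != 0 by rewrite expf_neq0.
have dV := is_deriveV (f := fun y : R => (1 + E y) ^+ 2) (x := x) E2 dE1.
have dx := is_deriveV (f := id) (x := x) (lt0r_neq0 x0) (is_derive_id x 1).
apply: derivableM; last exact: ex_derive.
by apply: derivableM; [apply: derivableM => //; exact: ex_derive|exact: ex_derive].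
Qed.

Let kern_ge0 (x : R) : 0 < x -> 0 <= kern x.
Proof.
by move=> x0; rewrite /kern !mulr_ge0 ?invr_ge0 ?exprn_ge0 ?addr_ge0 ?expR_ge0 ?ltW.
Qed.

(** With y = [E x], the inequality is min (y, 1/y) <= 4 y / (1 + y)^2 up to the common factor
    1/x. *)
Let kern_ge (x : R) : 0 < x ->
  expR (- ln x - c * `|ln x|) <= 4 / c * kern x.
Proof.
move=> x0; rewrite expRD expRN lnK ?posrE//.
rewrite (_ : 4 / c * kern x = x^-1 * (4 * E x * (1 + E x) ^- 2)); last first.
  by rewrite /kern; field; rewrite E1_neq0 !gt_eqF.
rewrite ler_pM2l ?invr_gt0//.
have E0 : 0 < E x by exact: expR_gt0.
have D0 : 0 < (1 + E x) ^+ 2 by rewrite exprn_gt0// addr_gt0.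
rewrite ler_pdivlMr//.
have [l0|l0] := leP 0 (ln x).
  rewrite ger0_norm// -/(E x).
  have : E x <= 1 by rewrite -expR0 ler_expR oppr_le0 mulr_ge0// ltW.
  move: (E x) E0 => y y0 y1; nra.
rewrite ltr0_norm// mulrN opprK -[c * ln x]opprK expRN -/(E x).
have : 1 <= E x by rewrite -expR0 ler_expR oppr_ge0 mulr_ge0_le0// ltW.
move: (E x) E0 => y y0 y1; rewrite mulrC ler_pdivrMr//; nra.
Qed.

(** [kern] is the derivative of [H], whose values lie between 0 and 1. The shift by 2 keeps the
    endpoints distinct. *)
Let kern_itv (k : nat) :
  (\int[mu]_(x in `[(k.+2%:R^-1)%R, k.+2%:R%R]) (kern x)%:E <= 1)%E.
Proof.
have k0 : 0 < (k.+2%:R : R)^-1 by rewrite invr_gt0.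
have kk : (k.+2%:R : R)^-1 < k.+2%:R.
  by rewrite (@lt_trans _ _ 1)// ?invf_lt1// ltr1n.
have pos x : (k.+2%:R : R)^-1 <= x -> 0 < x by apply: lt_le_trans.
have cH x : 0 < x -> {for x, continuous H}.
  move=> /H_derive dH; apply/differentiable_continuous/derivable1_diffP.
  exact: ex_derive.
rewrite (@continuous_FTC2 _ kern H)//.
- rewrite -EFinB lee_fin /H.
  have b1 x : (1 + E x)^-1 <= 1.
    by rewrite invf_le1 ?lerDl ?expR_ge0// addr_gt0 ?expR_gt0.
  have b0 x : 0 <= (1 + E x)^-1 by rewrite invr_ge0 addr_ge0 ?expR_ge0.
  have := b1 k.+2%:R; have := b0 (k.+2%:R^-1); lra.
- apply: derivable_within_continuous => x.
  by rewrite in_itv/= => /andP[/pos x0 _]; exact: kern_derivable.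
- split.
  + move=> x; rewrite in_itv/= => /andP[/ltW/pos/H_derive dH _].
    exact: ex_derive.
  + by apply: cvg_at_right_filter; exact: cH.
  + by apply: cvg_at_left_filter; apply: cH; rewrite ltr0n.
- move=> x; rewrite in_itv/= => /andP[/ltW/pos/H_derive dH _].
  by rewrite derive1E derive_val.
Qed.

Let measurable_kern : measurable_fun (`]0%R, +oo[%classic : set RR) (EFin \o kern).
Proof.
apply/measurable_EFinP; apply: open_continuous_measurable_fun.
  exact: interval_open.
move=> x; rewrite inE/= in_itv/= andbT => x0.
exact/differentiable_continuous/derivable1_diffP/kern_derivable.
Qed.

(** Monotone convergence along the intervals of [kern_itv], which exhaust the half-line. *)
Let kern_itvy : (\int[mu]_(x in `]0%R, +oo[) (kern x)%:E <= 1)%E.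
Proof.
pose F (k : nat) : set RR := `[(k.+2%:R^-1)%R, k.+2%:R]%classic.
have F0 k (x : R) : F k x -> 0 < x.
  by rewrite /F/= in_itv/= => /andP[+ _]; apply: lt_le_trans; rewrite invr_gt0.
have UF : `]0%R, +oo[%classic = \bigcup_k F k.
  apply/seteqP; split => x /=; rewrite in_itv/= andbT; last first.
    by move=> [k _]; exact: F0.
  (* A bound on x + 1/x controls both endpoints at once. *)
  move=> x0; pose k := `|Num.ceil (x + x^-1)|%N.
  have xk : x + x^-1 <= k.+2%:R.
    rewrite (le_trans (ceil_ge _))// -addn2 natrD /k natr_absz ger0_norm ?lerDl//.
    by rewrite ceil_ge0 (lt_le_trans (ltrN10 R))// addr_ge0 ?invr_ge0// ltW.
  exists k => //; rewrite /F/= in_itv/=; apply/andP; split.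
    rewrite -[leRHS]invrK lef_pV2 ?posrE ?invr_gt0//.
    by rewrite (le_trans _ xk)// lerDr ltW.
  by rewrite (le_trans _ xk)// lerDl invr_ge0 ltW.
rewrite UF; have cvgF : (\int[mu]_(x in F i) (kern x)%:E @[i --> \oo] -->
    \int[mu]_(x in \bigcup_i F i) (kern x)%:E)%E.
  apply: ge0_nondecreasing_set_cvg_integral.
  - apply/nondecreasing_seqP => k; apply/subsetPset => x.
    rewrite /F/= !in_itv/= => /andP[kx xk]; apply/andP; split.
      by rewrite (le_trans _ kx)// lef_pV2 ?posrE// ler_nat.
    by rewrite (le_trans xk)// ler_nat.
  - by move=> k; exact: measurable_itv.
  - move=> k; apply: measurable_funS measurable_kern => //.
    by move=> x /F0 x0; rewrite /= in_itv/= x0.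
  - by move=> k x /F0 x0; rewrite lee_fin kern_ge0.
rewrite -(cvg_lim _ cvgF)//; apply: lime_le; first exact: cvgP cvgF.
by apply: nearW => k; exact: kern_itv.
Qed.

(** The majorant is 4 / c times [kern] on the positive half-line, extended by 0 and added to its
    mirror image under x -> - x. *)
Lemma integrable_power_majorant : exists h : R -> R,
  [/\ forall x, 0 <= h x, measurable_fun setT (h : RR -> R),
      (\int[mu]_x (h x)%:E < +oo)%E &
      forall x, x != 0 -> expR (- ln `|x| - c * `|ln `|x| |) <= h x].
Proof.
pose g : RR -> R := (fun x => 4 / c * kern x)%R \_ `]0, +oo[%classic.
have c4 : 0 <= 4 / c by rewrite divr_ge0// ltW.
have gE (x : R) : 0 < x -> g x = 4 / c * kern x.
  by move=> x0; rewrite /g patchE mem_setE in_itv/= x0.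
have g0 x : 0 <= g x.
  rewrite /g patchE mem_setE in_itv/= andbT; case: ifPn => // x0.
  by rewrite mulr_ge0// kern_ge0.
have mg : measurable_fun setT g.
  apply/(measurable_restrictT _ _).1; first exact: measurable_itv.
  by apply: measurable_funM => //; apply/measurable_EFinP.
pose gN : RR -> R := fun x => g (- x).
have mgN : measurable_fun setT gN by apply: measurableT_comp.
have ig : (\int[mu]_x (g x)%:E < +oo)%E.
  apply: (@le_lt_trans _ _ (4 / c)%:E); last exact: ltry.
  have -> : (\int[mu]_x (g x)%:E =
      \int[mu]_(x in `]0%R, +oo[) ((4 / c)%:E * (kern x)%:E))%E.
    rewrite [RHS]integral_mkcond; apply: eq_integral => x _.
    by rewrite /g !patchE; case: ifPn.
  rewrite ge0_integralZl_EFin//; first last.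
    by move=> x; rewrite /= in_itv/= andbT => x0; rewrite lee_fin kern_ge0.
  by rewrite -[leRHS]mule1 lee_pmul2l// lte_fin divr_gt0.
have igN : (\int[mu]_x (gN x)%:E < +oo)%E.
  have n1 : (-1 : R) != 0 by rewrite oppr_eq0 oner_eq0.
  have := ge0_integral_affine (f := fun x => (g x)%:E) 0 n1.
  rewrite normrN1 mul1e.
  under eq_integral do rewrite mulN1r addr0.
  rewrite /gN => ->//; exact/measurable_EFinP.
exists (fun x => g x + gN x); split.
- by move=> x; rewrite addr_ge0// /gN.
- exact: measurable_funD.
- under eq_integral do rewrite EFinD.
  have g0E x : setT x -> (0 <= (g x)%:E)%E by rewrite lee_fin.
  have gN0E x : setT x -> (0 <= (gN x)%:E)%E by rewrite lee_fin /gN.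
  have mgE : measurable_fun setT (fun x => (g x)%:E) by exact/measurable_EFinP.
  have mgNE : measurable_fun setT (fun x => (gN x)%:E) by exact/measurable_EFinP.
  rewrite (ge0_integralD mu measurableT g0E mgE gN0E mgNE).
  exact: lte_add_pinfty ig igN.
- move=> x; rewrite neq_lt => /orP[x0|x0].
    by rewrite ltr0_norm// ler_wpDl// /gN gE ?oppr_gt0// kern_ge// oppr_gt0.
  by rewrite gtr0_norm// ler_wpDr /gN// gE// kern_ge.
Qed.

End Kernel.

(** * Integrals of products of one-variable functions *)

Section Product.
Context {R : realType}.
Local Notation RR := (measurableTypeR R).
Local Notation mu := (@lebesgue_measure R).
Local Notation lt := (@lebesgue_tuple R).

Lemma measurable_rv_prod n (h : 'I_n -> R -> R) :
  (forall i, measurable_fun setT (h i : RR -> R)) ->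
  measurable_rv (fun v : 'rV_n => (\prod_i h i (v 0 i))%:E).
Proof.
move=> mh; apply/measurable_EFinP; apply: measurable_prod => i _.
by apply: (measurableT_comp (mh i)); exact: measurable_vec.
Qed.

Lemma integral_prod n (h : 'I_n -> R -> R) (c : 'I_n -> R) :
  (forall i x, 0 <= h i x) ->
  (forall i, measurable_fun setT (h i : RR -> R)) ->
  (forall i, \int[mu]_x (h i x)%:E = (c i)%:E)%E ->
  (\int[lt n]_t (\prod_i h i (vec t 0 i))%:E = (\prod_i c i)%:E)%E.
Proof.
elim: n h c => [|n IH] h c h0 mh hc.
  (* In dimension 0 the measure is a Dirac mass, so the empty product integrates to 1. *)
  under eq_integral do rewrite big_ord0.
  rewrite big_ord0 integral_cst// mul1e /=.
  by rewrite diracE mem_set.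
have mp := measurable_rv_prod mh.
rewrite (integral_consrv1 (f := fun v => (\prod_i h i (v 0 i))%:E) mp); last first.
  by move=> v; rewrite lee_fin prodr_ge0.
have P0 : 0 <= \prod_i c (lift ord0 i).
  rewrite prodr_ge0// => i _; rewrite -lee_fin -hc.
  by apply: integral_ge0 => x _; rewrite lee_fin.
under eq_integral => x _.
  under eq_integral => t _.
    rewrite big_ord_recl consrv0.
    under eq_bigr do rewrite consrv_lift.
    rewrite EFinM; over.
  rewrite ge0_integralZl_EFin//; last 2 first.
    - by move=> t _; rewrite lee_fin prodr_ge0.
    - exact: (measurable_rv_prod (fun i => mh (lift ord0 i))).
  rewrite (IH (fun i => h (lift ord0 i)) (fun i => c (lift ord0 i)))//.
  rewrite muleC; over.
rewrite ge0_integralZl_EFin//; last 2 first.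
  - by move=> x _; rewrite lee_fin.
  - exact/measurable_EFinP.
by rewrite hc -EFinM big_ord_recl mulrC.
Qed.

End Product.

(** * Finite and infinite measure of the region *)

Section Region.
Context {R : realType}.
Local Notation RR := (measurableTypeR R).
Local Notation mu := (@lebesgue_measure R).
Local Notation lt := (@lebesgue_tuple R).
Variables (n : nat) (e : rel 'I_n.+1) (C : R) (S : set 'rV[R]_n.+1).
Hypothesis esym : symmetric e.
Hypothesis C0 : 0 < C.
Hypothesis mS : measurable_rv (fun v => (\1_S v : R)%:E).

(** After rescaling by sqrt C the logarithms u_i satisfy the edge inequalities of [sum_le_norm].
    Averaging its conclusion over the n + 1 vertices gives sum_i (u_i + c |u_i|) <= 0 with c = 1 /
    (n + 1), so the product of the majorants is at least 1 on [S]. *)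
Lemma integral_region_lty :
  (forall I, I != finset.set0 -> stable_set e I -> (#|I| < #|boundary_set e I|)%N) ->
  (forall v, S v -> (forall i, v 0 i != 0) /\
     forall i j, e i j -> `|v 0 i| * `|v 0 j| <= C) ->
  (\int[lt n.+1]_t (\1_S (vec t))%:E < +oo)%E.
Proof.
move=> expanding SC.
pose c : R := n.+1%:R^-1.
have c0 : 0 < c by rewrite invr_gt0.
have [h [h0 mh ih hge]] := integrable_power_majorant c0.
pose r := Num.sqrt C; have r0 : 0 < r by rewrite sqrtr_gt0.
have rr : r * r = C by rewrite -expr2 sqr_sqrtr// ltW.
have ri0 : r^-1 != 0 by rewrite invr_neq0// gt_eqF.
pose hr (x : R) := h (r^-1 * x + 0).
have mhr : measurable_fun setT (hr : RR -> R).
  exact: (measurableT_comp mh (measurable_affine r^-1 0)).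
have hr0 x : 0 <= hr x by exact: h0.
have [k kE] : exists k, (\int[mu]_x (hr x)%:E = k%:E)%E.
  exists (fine (\int[mu]_x (hr x)%:E)%E); rewrite fineK//.
  have i0 : (0 <= \int[mu]_x (hr x)%:E)%E.
    by apply: integral_ge0 => x _; rewrite lee_fin.
  rewrite ge0_fin_numE//.
  (* The integral of [hr] times 1/r is the finite integral of [h], so it cannot be infinite. *)
  have := ge0_integral_affine (f := fun x => (h x)%:E) 0 ri0.
  rewrite gtr0_norm ?invr_gt0// => hE.
  have mhE : measurable_fun setT (fun x : RR => (h x)%:E) by exact/measurable_EFinP.
  have hE0 (x : RR) : (0 <= (h x)%:E)%E by rewrite lee_fin.
  move: ih; rewrite -(hE mhE hE0) -/hr; move: i0; rewrite /hr.
  case: (integral _ _ _) => [x _ _|_|//]; first exact: ltry.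
  by rewrite gt0_muley// lte_fin invr_gt0.
have bound v : \1_S v <= \prod_i hr (v 0 i).
  rewrite indicE; case: (boolP (v \in S)); last by rewrite prodr_ge0.
  rewrite inE => /SC[v0 eC].
  pose w i := `|r^-1 * v 0 i|; pose u i := ln (w i).
  have w0 i : 0 < w i by rewrite normr_gt0 mulf_neq0.
  have eu i j : e i j -> u i + u j <= 0.
    move=> eij; rewrite /u -lnM ?posrE// ln_le0//.
    rewrite /w !normrM mulrACA -expr2 gtr0_norm ?invr_gt0// exprVn expr2 rr.
    by rewrite mulrC ler_pdivrMr// mul1r eC.
  have su := sum_le_norm esym expanding eu.
  apply: (@le_trans _ _ (\prod_i expR (- ln (w i) - c * `|ln (w i)|))); last first.
    apply: ler_prod => i _; rewrite expR_ge0/= /hr addr0 hge//.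
    by rewrite mulf_neq0.
  rewrite -expR_sum -expR0 ler_expR big_split/= !sumrN -mulr_sumr.
  rewrite -opprD oppr_ge0 -/u addrC -lerBrDr sub0r.
  rewrite /c mulrC ler_pdivrMr ?ltr0n//.
  have : \sum_(i < n.+1) `|u i| <= \sum_(i < n.+1) - \sum_(j < n.+1) u j.
    by apply: ler_sum => i _; rewrite lerNr su.
  by rewrite sumr_const card_ord mulr_natr.
have mp := measurable_rv_prod (h := fun _ : 'I_n.+1 => hr) (fun=> mhr).
apply: (@le_lt_trans _ _ (\int[lt n.+1]_t (\prod_i hr (vec t 0 i))%:E)%E).
  apply: ge0_le_integral => //.
  by move=> t _; rewrite lee_fin.
by rewrite (integral_prod _ (fun=> mhr) (fun=> kE))// ltry.
Qed.

(* The boxes t_i in [a_i, 2 a_i[ with a_i = l 2^m on I, l 2^-m on the boundary of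
   I and l elsewhere are pairwise disjoint, and of volume bounded below. *)
Lemma integral_region_pinfty (I : {set 'I_n.+1}) :
  I != finset.set0 -> stable_set e I -> (#|boundary_set e I| <= #|I|)%N ->
  (forall v : 'rV[R]_n.+1, (forall i, 0 < v 0 i) ->
     (forall i j, e i j -> v 0 i * v 0 j <= C) -> S v) ->
  (\int[lt n.+1]_t (\1_S (vec t))%:E = +oo)%E.
Proof.
move=> /set0Pn[i0 i0I] stI leI CS; set J := boundary_set e I.
have JI i : i \in J -> i \notin I by rewrite inE => /andP[].
(* Half of sqrt C, because the coordinates in a box range up to twice their lower bound. *)
pose l := Num.sqrt C / 2; have l0 : 0 < l by rewrite divr_gt0 ?sqrtr_gt0.
have ll : 2 * l * (2 * l) = C.
  by rewrite (mulrC 2) divfK// -expr2 sqr_sqrtr// ltW.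
pose s m i : R := (2 ^+ m) ^+ (i \in I) * (2 ^- m) ^+ (i \in J).
have s0 m i : 0 < s m i by rewrite mulr_gt0// exprn_gt0// ?invr_gt0 exprn_gt0.
have s_le1 m i : i \notin I -> s m i <= 1.
  move=> /negbTE iI; rewrite /s iI expr0 mul1r exprn_ile1// ?invr_ge0 ?exprn_ge0//.
  by rewrite invf_le1 ?exprn_gt0// exprn_ege1// ler1n.
(* By stability an edge meeting I ends in J, where the two scalings cancel; away from I both factors
   are at most 1. *)
have se m i j : e i j -> s m i * s m j <= 1.
  wlog iI : i j / i \in I.
    move=> h eij; have [iI|iI] := boolP (i \in I); first exact: h.
    have [jI|jI] := boolP (j \in I); first by rewrite mulrC h// esym.
    by rewrite mulr_ile1 ?s_le1// ltW.
  move=> eij; have jI : j \notin I.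
    apply/negP => jI; move/forall_inP : stI => /(_ i iI)/forall_inP/(_ j jI).
    by rewrite eij.
  have jJ : j \in J by rewrite inE jI; apply/exists_inP; exists i.
  have iJ : i \in J = false by apply/negP => /JI; rewrite iI.
  by rewrite /s iI iJ (negbTE jI) jJ expr1 !expr0 mulr1 mul1r expr1 mulfV// expf_neq0.
pose a m i := l * s m i; have a0 m i : 0 < a m i by exact: mulr_gt0.
have sumP (A : {set 'I_n.+1}) : (\sum_i (i \in A : nat))%N = #|A|.
  by rewrite -sum1_card [RHS]big_mkcond; apply: eq_bigr => i _; case: (i \in A).
(* The scalings multiply to 2^(m (|I| - |J|)), which is at least 1. *)
have prod_a m : l ^+ n.+1 <= \prod_i a m i.
  rewrite big_split/= prodr_const card_ord ler_pMr ?exprn_gt0//.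
  rewrite big_split/= !prodrXr (sumP I) (sumP J) -(subnK leI) exprD -mulrA.
  rewrite -exprMn mulfV ?expf_neq0// expr1n mulr1.
  by rewrite -exprM exprn_ege1// ler1n.
pose D m i : set RR := `[a m i, 2 * a m i[%classic.
pose box m (v : 'rV[R]_n.+1) : R := \prod_i \1_(D m i) (v 0 i).
have D0 m i x : 0 <= (\1_(D m i) x : R) by rewrite indicE.
have mD m i : measurable_fun setT (\1_(D m i) : RR -> R).
  by apply: measurable_indic; exact: measurable_itv.
have iD m i : (\int[mu]_x (\1_(D m i) x)%:E = (a m i)%:E)%E.
  rewrite integral_indic//= ?setIT; last exact: measurable_itv.
  rewrite lebesgue_measure_itv/= lte_fin ltr_pMl// ltr1n -EFinB.
  by congr EFin; ring.
have ibox m : (\int[lt n.+1]_t (box m (vec t))%:E = (\prod_i a m i)%:E)%E.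
  exact: (integral_prod (h := fun i => \1_(D m i)) (D0 m) (mD m) (iD m)).
have mbox m : measurable_rv (fun v => (box m v)%:E).
  exact: (measurable_rv_prod (h := fun i => \1_(D m i)) (mD m)).
have box0 m v : 0 <= box m v by exact: prodr_ge0.
have boxE m (v : 'rV[R]_n.+1) : (forall i, v 0 i \in D m i) \/ box m v = 0.
  have [/forallP|/forallPn[i vi]] := boolP [forall i, v 0 i \in D m i].
    by left.
  by right; rewrite /box (bigD1 i)//= indicE (negbTE vi) mul0r.
have boxS m (v : 'rV[R]_n.+1) : (forall i, v 0 i \in D m i) -> S v.
  move=> vD; have vi i : a m i <= v 0 i < 2 * a m i.
    by have := set_mem (vD i); rewrite /D/= in_itv.
  have vi0 i : 0 < v 0 i by have /andP[+ _] := vi i; apply: lt_le_trans.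
  apply: CS => // i j eij.
  have /andP[_ /ltW h1] := vi i; have /andP[_ /ltW h2] := vi j.
  apply: (le_trans (ler_pM (ltW (vi0 i)) (ltW (vi0 j)) h1 h2)).
  rewrite (_ : _ * _ = C * (s m i * s m j)); last by rewrite -ll /a; ring.
  by rewrite ler_piMr ?se// ltW.
have box_le1 m v : box m v <= 1.
  by rewrite prodr_ile1// => i _; rewrite D0 indicE lern1 leq_b1.
(* The coordinate [i0] in I separates the boxes: it ranges over [l 2^m, l 2^(m+1)[. *)
have box_disj m m' (v : 'rV[R]_n.+1) :
    (m < m')%N -> (forall i, v 0 i \in D m i) -> box m' v = 0.
  move=> mm' /(_ i0) vm; have [/(_ i0) vm'|//] := boxE m' v.
  move: (set_mem vm) (set_mem vm').
  rewrite /D/= !in_itv/= => /andP[_ h1] /andP[h2 _].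
  have := le_lt_trans h2 h1; rewrite /a /s i0I.
  have i0J : i0 \in J = false by apply/negP => /JI; rewrite i0I.
  rewrite i0J !expr1 !expr0 !mulr1 mulrCA ltr_pM2l// -exprS.
  have le2 : (2 : R) ^+ m.+1 <= 2 ^+ m' by rewrite ler_eXn2l// ltr1n.
  by rewrite ltNge le2.
have sum_box N v : \sum_(m < N) box m v <= \1_S v.
  have [/existsP[m /forallP vm]|/existsPn none] :=
      boolP [exists m : 'I_N, [forall i, v 0 i \in D m i]].
    rewrite (bigD1 m)//= [X in _ + X]big1; last first.
      move=> m' mm'; have [vm'|//] := boxE m' v.
      have [lt_mm'|lt_mm'|/val_inj mE] := ltngtP m m'.
      - exact: box_disj lt_mm' vm.
      - have := box_disj _ _ _ lt_mm' vm'.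
        rewrite /box; under eq_bigr do rewrite indicE vm.
        by rewrite big1// => /eqP; rewrite oner_eq0.
      - by rewrite mE eqxx in mm'.
    by rewrite addr0 indicE mem_set ?box_le1//; exact: boxS vm.
  rewrite big1 ?indicE// => m _.  have [vm|//] := boxE m v.
   by case/negP: (none m); apply/forallP.
apply: eq_infty => x.
(* Any real [x] is exceeded by the total volume of sufficiently many boxes. *)
have [N Nx] : exists N, x <= N%:R * l ^+ n.+1.
  exists (Num.bound `|x / l ^+ n.+1|); rewrite -ler_pdivrMr ?exprn_gt0//.
  by rewrite (le_trans (ler_norm _))// ltW// archi_boundP.
apply: (@le_trans _ _ (\int[lt n.+1]_t (\sum_(m < N) (box m (vec t))%:E))%E); last first.
  apply: ge0_le_integral => //.
  - by move=> t _; apply: sume_ge0 => m _; rewrite lee_fin.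
  - by apply: emeasurable_sum => m; exact: (mbox m).
  - by move=> t _; rewrite sumEFin lee_fin.
rewrite ge0_integral_sum//; last 2 first.
- by move=> m; exact: (mbox m).
- by move=> m t _; rewrite lee_fin.
under eq_bigr do rewrite ibox.
rewrite sumEFin lee_fin (le_trans Nx)//.
rewrite mulr_natl -[X in _ *+ X]card_ord -sumr_const.
exact: ler_sum.
Qed.

End Region.

(** * Projective simplices *)

Section OpenCone.
Context {R : realType} {n : nat}.
Variable M : 'M[R]_n.+1.
Hypothesis uM : M \in unitmx.
Local Notation V := 'rV[R]_n.+1.
Local Notation RR := (measurableTypeR R).

(* The open simplicial cone spanned by the rows of M, together with its opposite. *)
Definition double_cone : set V :=
  [set u | (forall i, 0 < (u *m invmx M) 0 i) \/
           (forall i, (u *m invmx M) 0 i < 0)].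

Lemma double_coneZ (r : R) (u : V) : r != 0 -> double_cone (r *: u) <-> double_cone u.
Proof.
have imp (c : R) (v : V) : c != 0 -> double_cone v -> double_cone (c *: v).
  rewrite neq_lt => /orP[c0|c0] [h|h]; [right|left|left|right] => i;
    rewrite -scalemxAl mxE.
  - by rewrite nmulr_rlt0.
  - by rewrite nmulr_rgt0.
  - by rewrite mulr_gt0.
  - by rewrite pmulr_rlt0.
move=> r0; split; last exact: imp.
by move=> /(imp r^-1); rewrite scalerA mulVf// scale1r invr_eq0; apply.
Qed.

Lemma double_cone_neq0 u : double_cone u -> u != 0.
Proof.
by move=> [|] /(_ 0) + ; apply: contraTN => /eqP ->; rewrite mul0mx mxE ltxx.
Qed.

Lemma continuous_mulmx_coord (N : 'M[R]_n.+1) i :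
  continuous (fun u : V => (u *m N) 0 i).
Proof.
rewrite (_ : (fun _ => _) = (fun u : V => \sum_k u 0 k * N k i)); last first.
  by apply/funext => u; rewrite mxE.
apply: continuous_big => [|k _ u]; first exact: add_continuous.
exact: (cvgMr_tmp (b := N k i) (@coord_continuous R 1 n.+1 0 k u)).
Qed.

Lemma open_double_cone : open double_cone.
Proof.
rewrite openE => u; rewrite /interior => -[] h.
- have nu i : nbhs u [set v : V | 0 < (v *m invmx M) 0 i].
    apply: (@continuous_mulmx_coord (invmx M) i u [set x | x > 0]).
    by apply: open_nbhs_nbhs; split; [exact: open_gt|exact: h].
  by apply: filterS (filter_forall _ nu) => v; left.
- have nu i : nbhs u [set v : V | (v *m invmx M) 0 i < 0].
    apply: (@continuous_mulmx_coord (invmx M) i u [set x | x < 0]).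
    by apply: open_nbhs_nbhs; split; [exact: open_lt|exact: h].
  by apply: filterS (filter_forall _ nu) => v; right.
Qed.

Lemma measurable_double_cone :
  measurable [set t : n.+1.-tuple RR | double_cone (vec t)].
Proof.
have m i : measurable_fun setT
    ((fun t => (vec t *m invmx M) 0 i) : n.+1.-tuple RR -> RR).
  exact: measurable_vec_mulmx.
rewrite (_ : mkset _ =
  (\bigcap_(i in [set: 'I_n.+1]) [set t : n.+1.-tuple RR | 0 < (vec t *m invmx M) 0 i])
  `|` (\bigcap_(i in [set: 'I_n.+1]) [set t | (vec t *m invmx M) 0 i < 0])).
  apply: measurableU; apply: fin_bigcap_measurable => // i _.
    rewrite -[X in measurable X]setTI.
    exact: (measurable_fun_ltr (measurable_cst (0 : R)) (m i) measurableT
      (Y := [set true])).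
  rewrite -[X in measurable X]setTI.
  exact: (measurable_fun_ltr (m i) (measurable_cst (0 : R)) measurableT
    (Y := [set true])).
apply/seteqP; split => t /=.
  by move=> [h|h]; [left|right] => i _ /=; exact: h.
by move=> [h|h]; [left|right] => i; exact: h.
Qed.

End OpenCone.

(** * The convex hull of a simplex as a double cone *)

Section Simplex.
Context {R : realType} {n : nat}.
Local Notation V := 'rV[R]_n.+1.
Local Notation P := (pspace R n).
Variables (L : {fset P}) (s : P -> V).
Hypothesis sL : is_lift L s.
Hypothesis cardL : #|` L|%fset = n.+1.
Hypothesis spanL : (\sum_(xi <- L) val xi)%VS = fullv.

Lemma pspace_line (xi : P) x : x \in val xi -> x != 0 -> val xi = <[x]>%VS.
Proof.
move=> xxi x0; apply/eqP; rewrite eq_sym eqEdim dim_vline x0 (eqP (valP xi)) leqnn.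
by rewrite andbT -memvE.
Qed.

Lemma pspace_collinear (xi : P) x y : x \in val xi -> y \in val xi -> x != 0 ->
  y != 0 -> exists2 r : R, r != 0 & y = r *: x.
Proof.
move=> xxi yxi x0 y0; move: yxi; rewrite (pspace_line xxi x0) => /vlineP[r yE].
by exists r => //; apply: contra_neq y0 => r0; rewrite yE r0 scale0r.
Qed.

Definition span_point (x : V) (x0 : x != 0) : P :=
  exist _ <[x]>%VS (introT eqP (etrans (dim_vline x) (congr1 nat_of_bool x0))).

Definition vertex (i : 'I_n.+1) : P := tnth (Tuple (introT eqP cardL)) i.

(** Multiplying a row vector by the inverse of this matrix gives its coordinates in the basis of
    lifted vertices. *)
Definition vertex_mx : 'M[R]_n.+1 := \matrix_i s (vertex i).

Lemma vertex_in i : vertex i \in L.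
Proof. exact: mem_tnth. Qed.

Lemma vertexP xi : xi \in L -> exists i, xi = vertex i.
Proof. by move=> xiL; exact: (tnthP (Tuple (introT eqP cardL)) _ xiL). Qed.

Lemma vertex_inj : injective vertex.
Proof. exact/tuple_uniqP/fset_uniq. Qed.

Lemma sum_vertex (W : nmodType) (F : P -> W) :
  \sum_(xi <- L) F xi = \sum_i F (vertex i).
Proof. exact: (big_tuple _ _ (Tuple (introT eqP cardL))). Qed.

Lemma row_vertex_mx i : row i vertex_mx = s (vertex i).
Proof. by rewrite rowK. Qed.

Lemma vertex_mx_unit : vertex_mx \in unitmx.
Proof.
rewrite -row_full_unit -sub1mx; apply/row_subP => j.
set v := row j _; have : v \in (\sum_(i < n.+1) val (vertex i))%VS.
  rewrite -(big_tuple _ _ (Tuple (introT eqP cardL)) xpredT (fun xi => val xi)).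
  by rewrite spanL memvf.
move=> /memv_sumP[u uxi ->]; apply: summx_sub => i _.
have [sx s0] := sL (vertex_in i).
have := uxi i isT; rewrite (pspace_line sx s0) => /vlineP[c ->].
by rewrite scalemx_sub// -row_vertex_mx row_sub.
Qed.
Let N := invmx vertex_mx.

Lemma conv_liftP x : conv_lift L s x <->
  (forall i, 0 <= (x *m N) 0 i) /\ \sum_i (x *m N) 0 i = 1.
Proof.
split.
  move=> [t [t0 t1] ->].
  have -> : \sum_(xi <- L) t xi *: s xi = (\row_i t (vertex i)) *m vertex_mx.
    rewrite sum_vertex mulmx_sum_row; apply: eq_bigr => i _.
    by rewrite mxE row_vertex_mx.
  rewrite mulmxK ?vertex_mx_unit//; split=> [i|].
    by rewrite mxE t0// vertex_in.
  by rewrite -t1 sum_vertex; apply: eq_bigr => i _; rewrite mxE.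
(* The sum has at most one term: it picks the coordinate of index i at [vertex i] and is 0 outside
   [L]. *)
move=> [x0 x1]; pose t xi := \sum_(i | vertex i == xi) (x *m N) 0 i.
have tE i : t (vertex i) = (x *m N) 0 i.
  rewrite /t (eq_bigl (pred1 i)) ?big_pred1_eq// => j.
  by rewrite /= (inj_eq vertex_inj).
exists t.
  split; first by move=> xi xiL; exact: sumr_ge0.
  by rewrite sum_vertex -x1; apply: eq_bigr => i _.
rewrite sum_vertex -[LHS](mulmxKV vertex_mx_unit) mulmx_sum_row.
by apply: eq_bigr => i _; rewrite tE row_vertex_mx.
Qed.

Lemma popen_double_cone :
  popen [set xi : P | exists2 x, x \in val xi & double_cone vertex_mx x].
Proof.
rewrite /popen (_ : mkset _ = double_cone vertex_mx).
  exact: open_double_cone.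
apply/seteqP; split=> [x [x0 [xi [y yxi Ky] xxi]]|x Kx].
  have [r r0 ->] := pspace_collinear yxi xxi (double_cone_neq0 Ky) x0.
  exact/double_coneZ.
have x0 := double_cone_neq0 Kx; split => //.
by exists (span_point x0); [exists x|]; rewrite //= memv_line.
Qed.

Lemma pimage_conv_lift_sign xi x : pimage (conv_lift L s) xi -> x \in val xi ->
  (forall i, 0 <= (x *m N) 0 i) \/ (forall i, (x *m N) 0 i <= 0).
Proof.
move=> [y [/conv_liftP[y0 _] yn0 yxi]] xxi.
move: xxi; rewrite (pspace_line yxi yn0) => /vlineP[r ->].
have [r0|/ltW r0] := leP 0 r; [left|right] => i; rewrite -scalemxAl mxE.
  by rewrite mulr_ge0.
by rewrite mulr_le0_ge0.
Qed.

(* A boundary point of the closed cone can be pushed out of it: lower one of its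
   zero coordinates while keeping a positive one. *)
Lemma open_weak_sign (O : set V) x : open O -> O x -> x != 0 ->
  (forall y, O y -> (forall i, 0 <= (y *m N) 0 i) \/ (forall i, (y *m N) 0 i <= 0)) ->
  double_cone vertex_mx x.
Proof.
move=> oO Ox x0 sgO.
have x'0 : x *m N != 0.
  apply: contra_neq x0 => xN; by rewrite -[x](mulmxKV vertex_mx_unit) xN mul0mx.
(* An open set allows a small positive move in any direction. *)
have push (w : V) : exists2 h : R, 0 < h & O (x + h *: w).
  have cv : x + h *: w @[h --> (0 : R)^'+] --> x.
    rewrite -[X in _ --> X]addr0 -(scale0r w).
    apply: cvgD; first exact: cvg_cst.
    by apply: cvgZr_tmp; apply: cvg_at_right_filter; exact: cvg_id.
  have nO : nbhs x O by exact: open_nbhs_nbhs.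
  have near1 : \forall h \near (0 : R)^'+, O (x + h *: w) by exact: cv O nO.
  have near2 : \forall h \near (0 : R)^'+, O (x + h *: w) /\ 0 < h.
    by apply: filterI => //; exact: nbhs_right_gt.
  by have [h [Oh h0]] := filter_ex near2; exists h.
have pushE (w : V) h i : ((x + h *: (w *m vertex_mx)) *m N) 0 i =
    (x *m N) 0 i + h * w 0 i.
  by rewrite mulmxDl -scalemxAl mulmxK ?vertex_mx_unit// !mxE.
apply: contrapT => nK.
have [j xj] : exists j, (x *m N) 0 j != 0 by apply/rV0Pn.
have [xs|xs] := sgO x Ox.
- have [i xi] : exists i, (x *m N) 0 i = 0.
    apply: contrapT => none; apply: nK; left => i.
    by rewrite lt_neqAle xs andbT eq_sym; apply: contra_notN none => /eqP ?; exists i.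
  have [h h0 Oh] := push (- delta_mx 0 i *m vertex_mx).
  have ij : j == i = false by apply: contraNF xj => /eqP ->; rewrite xi.
  have dE k : (- delta_mx 0 i : V) 0 k = - (k == i)%:R by rewrite !mxE eqxx.
  have [/(_ i)|/(_ j)] := sgO _ Oh; rewrite pushE dE.
    by rewrite xi add0r eqxx mulrN1 oppr_ge0 leNgt h0.
  by rewrite ij oppr0 mulr0 addr0 leNgt lt_neqAle eq_sym xj xs.
- have [i xi] : exists i, (x *m N) 0 i = 0.
    apply: contrapT => none; apply: nK; right => i.
    by rewrite lt_neqAle xs andbT; apply: contra_notN none => /eqP ?; exists i.
  have [h h0 Oh] := push (delta_mx 0 i *m vertex_mx).
  have ij : j == i = false by apply: contraNF xj => /eqP ->; rewrite xi.
  have dE k : (delta_mx 0 i : V) 0 k = (k == i)%:R by rewrite !mxE eqxx.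
  have [/(_ j)|/(_ i)] := sgO _ Oh; rewrite pushE dE.
    by rewrite ij mulr0 addr0 leNgt lt_neqAle xj xs.
  by rewrite xi add0r eqxx mulr1 leNgt h0.
Qed.

(** Vectors over an open subset of the hull have coordinates of weakly constant sign, hence of
    strictly constant sign by [open_weak_sign]. Conversely the double cone is open and projects into
    the hull. *)
Lemma pconvP xi :
  pconv L s xi <-> exists2 x, x \in val xi & double_cone vertex_mx x.
Proof.
split.
  move=> [W [oW WC Wxi]].
  have [x x0 xxi] : exists2 x, x != 0 & x \in val xi.
    exists (vpick (val xi)); last exact: memv_pick.
    by rewrite vpick0 -dimv_eq0 (eqP (valP xi)).
  exists x => //; apply: (open_weak_sign oW) => //; first by split => //; exists xi.
  by move=> y [_ [eta Weta yeta]]; exact: pimage_conv_lift_sign (WC _ Weta) yeta.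
move=> [x xxi Kx].
exists [set xi : P | exists2 x, x \in val xi & double_cone vertex_mx x].
split; [exact: popen_double_cone| |by exists x].
(* Dividing by the coordinate sum, which has the common sign of the coordinates, yields a convex
   combination of the lifted vertices. *)
move=> eta [y yeta Ky]; set S := \sum_i (y *m N) 0 i.
have S0 : S != 0.
  case: Ky => Ky; [rewrite gt_eqF//|rewrite lt_eqF//].
    by rewrite /S big_ord_recl ltr_pwDl// ?sumr_ge0// => i _; exact: ltW.
  rewrite -oppr_gt0 /S -sumrN big_ord_recl ltr_pwDl ?oppr_gt0// sumr_ge0// => i _.
  by rewrite oppr_ge0 ltW.
exists (S^-1 *: y); split; last by rewrite memvZ.
  apply/conv_liftP; split.
    move=> i; rewrite -scalemxAl mxE mulrC; case: Ky => Ky.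
      by rewrite divr_ge0 ?(ltW (Ky i))// /S sumr_ge0// => k _; exact: ltW.
    rewrite mulr_le0 ?(ltW (Ky i))// invr_le0 /S -oppr_ge0 -sumrN sumr_ge0// => k _.
    by rewrite oppr_ge0 ltW.
  under eq_bigr do rewrite -scalemxAl mxE.
  by rewrite -mulr_sumr mulVf.
by rewrite scaler_eq0 invr_eq0 negb_or S0 (double_cone_neq0 Ky).
Qed.

End Simplex.

(** * The volume of a simplex and the edge inequalities *)

Section Volume.
Context {R : realType} {n : nat}.
Local Notation V := 'rV[R]_n.+1.
Local Notation P := (pspace R n).
Local Notation RR := (measurableTypeR R).
Local Notation lt := (@lebesgue_tuple R).
Variables (B : 'M[R]_n.+1) (L : {fset P}) (s : P -> V).
Hypothesis symB : B^T = B.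
Hypothesis uB : B \in unitmx.
Hypothesis posL : positive_lift B L s.
Hypothesis cardL : #|` L|%fset = n.+1.
Hypothesis spanL : (\sum_(xi <- L) val xi)%VS = fullv.

Let sL : is_lift L s. Proof. by case: posL. Qed.
Let M := vertex_mx s cardL.
Let uM : M \in unitmx. Proof. exact: vertex_mx_unit. Qed.
Let K := double_cone M.
Let Q (u : V) := - bform B u u.
(** The Gram matrix of the lifted vertices. *)
Let G := M *m B *m M^T.

Definition vertex_edge : rel 'I_n.+1 := fun i j =>
  bform B (s (vertex cardL i)) (s (vertex cardL j)) != 0.

Lemma vertex_edge_sym : symmetric vertex_edge.
Proof. by move=> i j; rewrite /vertex_edge bformC. Qed.

Let GE i j : G i j = bform B (s (vertex cardL i)) (s (vertex cardL j)).
Proof. by rewrite /G mulmx_bform !row_vertex_mx. Qed.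

Let G_le0 i j : G i j <= 0.
Proof. by rewrite GE; case: posL => _ _; apply; exact: vertex_in. Qed.

Let QE (t : V) : Q (t *m M) = \sum_i \sum_j t 0 i * t 0 j * - G i j.
Proof.
have -> : Q (t *m M) = - (t *m G *m t^T) 0 0.
  by rewrite /Q /bform /G trmx_mul !mulmxA.
rewrite mxE -sumrN exchange_big; apply: eq_bigr => j _.
rewrite [(t *m G) _ _]mxE [t^T _ _]mxE mulr_suml -sumrN; apply: eq_bigr => i _.
by ring.
Qed.

Let QZ (r : R) (u : V) : Q (r *: u) = r ^+ 2 * Q u.
Proof. by rewrite /Q bformZl bformZr //; ring. Qed.

Let coord_mul_gt0 (t : V) i j : K (t *m M) -> 0 < t 0 i * t 0 j.
Proof.
rewrite /K /double_cone /= mulmxK// => -[t0|t0]; first exact: mulr_gt0.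
by rewrite nmulr_rgt0.
Qed.

Let term_ge0 (t : V) i j : K (t *m M) -> 0 <= t 0 i * t 0 j * - G i j.
Proof. by move=> Kt; rewrite mulr_ge0 ?oppr_ge0// ltW// coord_mul_gt0. Qed.

(** On the double cone all terms of the expansion [QE] are nonnegative. *)
Let term_le (t : V) i j : K (t *m M) -> t 0 i * t 0 j * - G i j <= Q (t *m M).
Proof.
move=> Kt; rewrite QE (bigD1 i)//= (bigD1 j)//= -addrA lerDl addr_ge0//.
  by apply: sumr_ge0 => k _; exact: term_ge0.
by apply: sumr_ge0 => k _; apply: sumr_ge0 => l _; exact: term_ge0.
Qed.

(** As [B] is nondegenerate, [G] has a nonzero, hence negative, entry, and the corresponding term of
    [Q] is positive on the cone. *)
Let Q_gt0 (u : V) : K u -> 0 < Q u.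
Proof.
move=> Ku; have uE : u = (u *m invmx M) *m M by rewrite mulmxKV.
have Ku' := Ku; rewrite uE in Ku'.
have [i [j Gij]] : exists i j, G i j != 0.
  apply: contrapT => G0; have {}G0 : G = 0.
    apply/matrixP => i j; rewrite [RHS]mxE; apply/eqP/negPn/negP => Gij.
    by apply: G0; exists i, j.
  have : \det G != 0.
    rewrite !det_mulmx det_tr !mulf_neq0//; [move: uM|move: uB|move: uM];
    by rewrite unitmxE unitfE.
  by rewrite G0 det0 eqxx.
rewrite uE; apply: lt_le_trans (term_le i j Ku').
by rewrite mulr_gt0 ?coord_mul_gt0// oppr_gt0 lt_neqAle Gij G_le0.
Qed.

Let S := [set u | K u /\ Q u <= 1].

Let mS : measurable_rv (fun v => (\1_S v : R)%:E).
Proof.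
suff : measurable [set t : n.+1.-tuple RR | S (vec t)].
  move=> /(measurable_indic (R := R) (D := setT))/measurable_EFinP.
  rewrite /measurable_rv; apply: eq_measurable_fun => t _ /=.
  by rewrite !indicE; congr (_%:R%:E); congr nat_of_bool; apply/idP/idP; rewrite !inE.
rewrite (_ : mkset _ = [set t : n.+1.-tuple RR | K (vec t)] `&`
    [set t | Q (vec t) <= 1]); last by [].
apply: measurableI; first exact: measurable_double_cone.
have mQ : measurable_fun setT ((fun t => Q (vec t)) : n.+1.-tuple RR -> RR).
  apply: measurable_funN.
  rewrite (_ : (fun t => _) = (fun t : n.+1.-tuple RR =>
      \sum_j (vec t *m B) 0 j * vec t 0 j)); last first.
    by apply/funext => t; rewrite /bform mxE; apply: eq_bigr => j _; rewrite [_^T _ _]mxE.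
  apply: measurable_sum => j; apply: measurable_funM.
    exact: measurable_vec_mulmx.
  exact: measurable_vec.
rewrite -[X in measurable X]setTI.
exact: (measurable_fun_ler mQ (measurable_cst (1 : R)) measurableT (Y := [set true])).
Qed.

(** The description of the hull by [pconvP] is read in the chart; membership in [pseudo_hyperbolic]
    comes from [Q_gt0]. *)
Let traceP (y : n.-tuple RR) :
  affine_trace B (pconv L s) y <-> K (consrv 1 (vec y)).
Proof.
have c0 : consrv 1 (vec y) != 0.
  by apply/rV0Pn; exists 0; rewrite consrv0 oner_eq0.
split.
  move=> [xi [+ _] yxi] => /(pconvP sL cardL spanL)[x xxi Kx].
  have [r r0 yE] := pspace_collinear xxi yxi (double_cone_neq0 Kx) c0.
  have -> : consrv 1 (vec y) = r *: x by [].
  exact/(double_coneZ M x r0).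
move=> Ky; exists (span_point c0); last by rewrite /= memv_line.
split.
  apply/(pconvP sL cardL spanL); exists (consrv 1 (vec y)) => //.
  by rewrite /= memv_line.
move=> x /= /vlineP[r ->]; rewrite scaler_eq0 negb_or => /andP[r0 _].
by rewrite -oppr_gt0 -/(Q _) QZ pmulr_rgt0 ?Q_gt0// exprn_even_gt0.
Qed.

Let density (v : 'rV[R]_n) : \bar R :=
  (\1_K (consrv 1 v) * Num.sqrt (Q (consrv 1 v)) ^- n.+1)%:E.

Let hvolumeE : hvolume B (pconv L s) =
  ((Num.sqrt `|\det B|)%:E * \int[lt n]_t density (vec t))%E.
Proof.
rewrite /hvolume integral_mkcond -ge0_integralZl_EFin//.
- apply: eq_integral => t _; rewrite patchE /density; case: ifPn.
    rewrite inE => /traceP Kt; rewrite indicE mem_set// mul1r -EFinM.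
    by rewrite (sqrt_det_metric_mx symB)//; exact: Q_gt0.
  rewrite notin_setE => /traceP Kt; rewrite indicE memNset// mul0r mule0.
  by [].
- by move=> t _; rewrite lee_fin mulr_ge0 ?indicE// invr_ge0 exprn_ge0// sqrtr_ge0.
- exact: (measurable_cone_density (double_coneZ M) QZ Q_gt0 mS).
Qed.

(** The set [S] in the coordinates given by the lifted vertices. *)
Let S' := [set t : V | S (t *m M)].

Let mS' : measurable_rv (fun v => (\1_S' v : R)%:E).
Proof.
have := measurable_rvM M mS; rewrite /measurable_rv; apply: eq_measurable_fun.
by move=> t _; rewrite /= !indicE; congr (_%:R%:E); congr nat_of_bool; apply/idP/idP; rewrite !inE.
Qed.

Let mule_pinftyP (c : R) (x : \bar R) : 0 < c -> (c%:E * x = +oo <-> x = +oo)%E.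
Proof.
move=> c0; split; last by move=> ->; rewrite gt0_muley.
by case: x => [x| |] //; rewrite gt0_muleNy.
Qed.

(** The two quantities differ by sqrt |det B|, the radial constant and |det M|, all positive and
    finite. *)
Lemma hvolume_pinftyP :
  hvolume B (pconv L s) = +oo%E <-> (\int[lt n.+1]_t (\1_S' (vec t))%:E = +oo)%E.
Proof.
have detB : \det B != 0 by rewrite -unitfE -unitmxE.
have detM : \det M != 0 by rewrite -unitfE -unitmxE.
have [c c0 cE] := radial_cst_fin (R := R) n.
have f0 v : (0 <= (\1_S v : R)%:E)%E by rewrite lee_fin indicE.
have lin := scales_unitmx uM mS f0.
rewrite (integral_cone (double_coneZ M) QZ Q_gt0 mS) in lin.
rewrite cE -[RHS]/(c%:E * \int[lt n]_t density (vec t))%E in lin.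
have -> : (\int[lt n.+1]_t (\1_S' (vec t))%:E =
    \int[lt n.+1]_t (\1_S (vec t *m M))%:E)%E.
  apply: eq_integral => t _; rewrite !indicE.
  suff -> : (vec t \in S') = (vec t *m M \in S) by [].
  by apply/idP/idP; rewrite !inE.
rewrite hvolumeE mule_pinftyP; last by rewrite sqrtr_gt0 normr_gt0.
rewrite -(mule_pinftyP _ c0) -lin mule_pinftyP ?normr_gt0//.
Qed.

Lemma hvolume_pinfty (I : {set 'I_n.+1}) : I != finset.set0 ->
  stable_set vertex_edge I -> (#|boundary_set vertex_edge I| <= #|I|)%N ->
  hvolume B (pconv L s) = +oo%E.
Proof.
move=> I0 stI leI; apply/hvolume_pinftyP.
(* If all edge products are at most 1/D, then [Q] is at most (D - 1)/D; the summand 1 makes [D]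
   positive. *)
pose D := 1 + \sum_i \sum_j - G i j.
have D0 : 0 < D.
  rewrite ltr_pwDl// sumr_ge0// => i _; rewrite sumr_ge0// => j _.
  by rewrite oppr_ge0.
apply: (integral_region_pinfty vertex_edge_sym _ mS' I0 stI leI (C := D^-1)).
  by rewrite invr_gt0.
move=> v v0 ve; split.
  by left=> i; rewrite mulmxK.
rewrite QE; apply: (@le_trans _ _ (\sum_i \sum_j D^-1 * - G i j)).
  apply: ler_sum => i _; apply: ler_sum => j _.
  have [Gij|Gij] := eqVneq (G i j) 0; first by rewrite Gij oppr0 !mulr0.
  by rewrite ler_wpM2r ?oppr_ge0// ve// /vertex_edge -GE.
under eq_bigr do rewrite -mulr_sumr.
by rewrite -mulr_sumr mulrC ler_pdivrMr// mul1r lerDr.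
Qed.

Lemma hvolume_neq_pinfty :
  (forall I, I != finset.set0 -> stable_set vertex_edge I ->
     (#|I| < #|boundary_set vertex_edge I|)%N) ->
  hvolume B (pconv L s) <> +oo%E.
Proof.
move=> expanding /hvolume_pinftyP; apply/eqP; rewrite lt_eqF//.
(* [D] dominates each bound 1 / (- G i j) that Q <= 1 puts on an edge product. Non-edges contribute
   0, the inverse of 0 being 0. *)
pose D := 1 + \sum_i \sum_j (- G i j)^-1.
have Gi0 i j : 0 <= (- G i j)^-1 by rewrite invr_ge0 oppr_ge0.
have D0 : 0 < D.
  by rewrite ltr_pwDl// sumr_ge0// => i _; rewrite sumr_ge0.
apply: (integral_region_lty vertex_edge_sym D0 mS' expanding) => v [Kv Qv].
have v0 i : v 0 i != 0.
  have := coord_mul_gt0 i i Kv; rewrite -expr2.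
  by apply: contraTneq => ->; rewrite expr0n ltxx.
split=> // i j eij; rewrite -normrM gtr0_norm ?coord_mul_gt0//.
have Gij : 0 < - G i j by rewrite oppr_gt0 lt_neqAle G_le0 andbT GE.
have le1 := le_trans (term_le i j Kv) Qv.
rewrite -ler_pdivlMr// mul1r in le1.
apply: (le_trans le1); rewrite /D (bigD1 i)//= (bigD1 j)//=.
rewrite addrCA -addrA lerDl !addr_ge0// ?sumr_ge0// => k _.
by rewrite sumr_ge0.
Qed.

End Volume.

(** * From sets of vertices to sets of indices *)

Section Graph.
Context {R : realType} {n : nat}.
Local Notation P := (pspace R n).
Variables (B : 'M[R]_n.+1) (L : {fset P}) (s : P -> 'rV[R]_n.+1).
Hypothesis symB : B^T = B.
Hypothesis sL : is_lift L s.
Hypothesis cardL : #|` L|%fset = n.+1.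
Local Notation vertex := (vertex cardL).
Local Notation edge := (vertex_edge B s cardL).

(** Lines are orthogonal as soon as one nonzero vector of each are, so the lifted vectors decide
    adjacency. *)
Lemma adjacentP i j : Defs.adjacent B (vertex i) (vertex j) <-> edge i j.
Proof.
have [si si0] := sL (vertex_in cardL i); have [sj sj0] := sL (vertex_in cardL j).
split=> [adj|/eqP bij orth]; last by apply: bij; exact: orth.
apply/eqP => bij; apply: adj => x y.
rewrite (pspace_line si si0) (pspace_line sj sj0).
move=> /vlineP[a ->] /vlineP[c ->].
by rewrite bformZl bformZr// bij !mulr0.
Qed.

Lemma card_vertices (A : {fset P}) (I : {set 'I_n.+1}) : (A `<=` L)%fset ->
  (forall i, (vertex i \in A) = (i \in I)) -> #|` A|%fset = #|I|.
Proof.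
move=> AL AI; rewrite cardE -(size_map vertex).
apply/perm_size/uniq_perm; rewrite ?fset_uniq//.
  by rewrite map_inj_uniq ?enum_uniq//; exact: vertex_inj.
move=> xi; apply/idP/mapP => [xiA|[i]].
  have [i xiE] := vertexP cardL (fsubsetP AL _ xiA).
  by exists i => //; rewrite mem_enum -AI -xiE.
by rewrite mem_enum -AI => iA ->.
Qed.

Section Correspondence.
Variables (A : {fset P}) (I : {set 'I_n.+1}).
Hypothesis AL : (A `<=` L)%fset.
Hypothesis AI : forall i, (vertex i \in A) = (i \in I).

Lemma stable_vertices : stable B A <-> stable_set edge I.
Proof.
split=> [stA|/forall_inP stI xi eta xiA etaA].
  apply/forall_inP => i iI; apply/forall_inP => j jI; apply/negP => /adjacentP.
  by apply: stA; rewrite AI.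
have [i xiE] := vertexP cardL (fsubsetP AL _ xiA).
have [j etaE] := vertexP cardL (fsubsetP AL _ etaA).
move: xiA etaA; rewrite xiE etaE !AI => iI jI /adjacentP.
by apply/negP; move/forall_inP : (stI i iI); apply.
Qed.

Lemma card_graph_boundary : #|` graph_boundary B L A|%fset = #|boundary_set edge I|.
Proof.
apply: card_vertices; first by apply/fsubsetP => xi; rewrite !inE => /andP[].
move=> i; rewrite !inE vertex_in/= AI; congr (_ && _).
apply/asboolP/exists_inP => [[xi xiA adj]|[j jI eij]].
  have [j xiE] := vertexP cardL (fsubsetP AL _ xiA).
  by exists j; [rewrite -AI -xiE|apply/adjacentP; rewrite -xiE].
by exists (vertex j); [rewrite AI|apply/adjacentP].
Qed.

End Correspondence.

Lemma expanding_graphP :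
  (exists A : {fset P}, [/\ (A `<=` L)%fset, A != fset0, stable B A &
     (#|` graph_boundary B L A| <= #|` A|)%N]) <->
  (exists I : {set 'I_n.+1}, [/\ I != finset.set0, stable_set edge I &
     (#|boundary_set edge I| <= #|I|)%N]).
Proof.
split=> [[A [AL A0 stA leA]]|[I [I0 stI leI]]].
  pose I : {set 'I_n.+1} := [set i | vertex i \in A]%SET.
  have AI i : (vertex i \in A) = (i \in I) by rewrite inE.
  exists I; split.
  - have /fset0Pn[xi xiA] := A0; have [i xiE] := vertexP cardL (fsubsetP AL _ xiA).
    by apply/set0Pn; exists i; rewrite -AI -xiE.
  - exact: (stable_vertices AL AI).1.
  - by rewrite -(card_graph_boundary AL AI) -(card_vertices AL AI).
pose A : {fset P} := [fset xi in L | [exists i in I, vertex i == xi]]%fset.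
have AL : (A `<=` L)%fset by apply/fsubsetP => xi; rewrite !inE => /andP[].
have AI i : (vertex i \in A) = (i \in I).
  rewrite !inE vertex_in/=; apply/exists_inP/idP => [[j jI /eqP/vertex_inj <-//]|iI].
  by exists i.
exists A; split => //.
- by have /set0Pn[i iI] := I0; apply/fset0Pn; exists (vertex i); rewrite AI.
- exact: (stable_vertices AL AI).2.
- by rewrite (card_graph_boundary AL AI) (card_vertices AL AI).
Qed.

End Graph.

Lemma has_signature_unitmx (R : realType) p q n (B : 'M[R]_n) :
  has_signature p q B -> B \in unitmx.
Proof.
move=> [_ _ [P uP PBP]].
have : P *m B *m P^T \in unitmx.
  rewrite PBP unitmxE det_diag unitfE prodf_seq_neq0; apply/allP => i _ /=.
  by rewrite mxE; case: ifP => _; rewrite ?oppr_eq0 oner_eq0.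
by rewrite unitmx_mul => /andP[+ _]; rewrite unitmx_mul => /andP[].
Qed.

(** The positive lift [s] is arbitrary, so whether the volume is infinite is the same for every
    convex hull of the simplex. *)
Theorem mainTheorem1 (R : realType) (p q : nat) (B : 'M[R]_((p + q).+1))
    (L : {fset pspace R (p + q)}) (s : pspace R (p + q) -> 'rV[R]_((p + q).+1)) :
  (0 < p)%N ->
  has_signature p q.+1 B ->
  simplex B L ->
  positive_lift B L s ->
  hvolume B (pconv L s) = +oo%E <->
  exists I : {fset pspace R (p + q)},
    [/\ (I `<=` L)%fset, I != fset0, stable B I &
        (#|` graph_boundary B L I| <= #|` I|)%N].
Proof.
move=> _ sigB [_ cardL spanL] posL.
have uB := has_signature_unitmx sigB; have [_ symB _] := sigB.
have [sL _ _] := posL; rewrite (expanding_graphP symB sL cardL).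
split=> [volL|[I [I0 stI leI]]]; last exact: hvolume_pinfty I0 stI leI.
apply: contrapT => none; apply: hvolume_neq_pinfty volL => // I I0 stI.
by rewrite ltnNge; apply/negP => leI; apply: none; exists I.
Qed.
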